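(* Let $\mathcal{K}$ be a semi-equivelar map of type $[3^4,10^1]$ on a surface $S$ with Euler characteristic $-2$. Then $\mathcal{K}$ is isomorphic to $\mathcal{K}_1[3^4,10^1]$, $\mathcal{K}_2[3^4,10^1]$, $\mathcal{K}_3[3^4,10^1]$ or $\mathcal{K}_4[3^4,10^1]$, the four explicit maps specified in the context.
   Context: A surface is a connected closed 2-manifold (orientable or not). A map is a connected 2-dimensional cell complex on a surface (equivalently, a cellular embedding of a connected graph). All maps are polyhedral: a non-empty intersection of two distinct faces is either a vertex or an edge. A map is semi-equivelar of type $[3^4,10^1]$ if at every vertex the faces containing it form a cycle consisting of four triangles and one 10-gon. Two maps are isomorphic if there is a bijection between their vertex sets that carries cells (edges, faces) to cells in both directions. The four maps. Each $\mathcal{K}_t[3^4,10^1]$ has vertex set $\{1,\dots,30\}$ and three 10-gonal faces $F_1=[1,2,\dots,10]$, $F_3=[11,12,\dots,20]$, $F_2=[21,22,\dots,30]$. Write $i^+$ for the successor of $i$ in the cyclic order of its 10-gon ($i^+=i+1$, except $10^+=1$, $20^+=11$, $30^+=21$). For each $t$ let $\sigma=\sigma_t$ be the fixed-point-free involution of $\{1,\dots,30\}$ that swaps the two members of each of the following pairs: $t=1$: $\{1,30\},\{3,22\},\{5,26\},\{7,28\},\{9,24\},\{2,13\},\{4,19\},\{6,15\},\{8,17\},\{10,11\},\{12,23\},\{14,29\},\{16,25\},\{18,27\},\{20,21\}$. $t=2$: $\{1,30\},\{3,24\},\{5,28\},\{7,22\},\{9,26\},\{2,13\},\{4,15\},\{6,17\},\{8,19\},\{10,11\},\{12,25\},\{14,29\},\{16,23\},\{18,27\},\{20,21\}$.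 $t=3$: $\{1,30\},\{3,26\},\{5,22\},\{7,24\},\{9,28\},\{2,13\},\{4,17\},\{6,19\},\{8,15\},\{10,11\},\{12,27\},\{14,29\},\{16,23\},\{18,25\},\{20,21\}$. $t=4$: $\{1,30\},\{3,22\},\{5,24\},\{7,26\},\{9,28\},\{2,15\},\{4,19\},\{6,13\},\{8,17\},\{10,11\},\{12,27\},\{14,23\},\{16,29\},\{18,25\},\{20,21\}$. The 40 triangular faces of $\mathcal{K}_t[3^4,10^1]$ are: for each pair $\{i,j\}$ in the list, the two triangles $[i,i^+,j]$ and $[i,j,j^+]$ (30 triangles in total); and the 10 triangles whose vertex sets are the orbits (all of size 3) of the permutation $i\mapsto \sigma(i)^+$ of $\{1,\dots,30\}$ (for instance $[1,11,21]$ for every $t$). *)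

(* Defs.v *)
From HB Require Import structures.
From mathcomp Require Import all_boot all_order all_algebra.
From mathcomp Require Import finmap.
From mathcomp Require Import all_classical all_reals all_analysis.

Set Implicit Arguments.
Unset Strict Implicit.
Unset Printing Implicit Defensive.

Import Order.TTheory GRing.Theory Num.Theory.
Import numFieldNormedType.Exports.

Local Open Scope classical_set_scope.
Local Open Scope ring_scope.

(* [f] restricts to a homeomorphism from the subspace [A] onto the subspace
   [B]; its values outside [A] are irrelevant. *)
Definition homeomorphism_on (T U : topologicalType)
    (A : set T) (B : set U) (f : T -> U) : Prop :=
  [/\ set_bij A B f, {within A, continuous f} &
      exists g : U -> T, {within B, continuous g} /\ {in A, cancel f g}].

Definition closed_disc (R : realType) : set (R * R) :=
  [set p | p.1 ^+ 2 + p.2 ^+ 2 <= 1].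

Definition open_disc (R : realType) : set (R * R) :=
  [set p | p.1 ^+ 2 + p.2 ^+ 2 < 1].

Arguments closed_disc : clear implicits.
Arguments open_disc : clear implicits.

(* Connected closed 2-manifold, orientable or not. Second countability is
   automatic for compact locally Euclidean spaces. *)
Definition surface (R : realType) (S : topologicalType) : Prop :=
  [/\ [set: S] !=set0, hausdorff_space S, compact [set: S],
      connected [set: S] &
      forall x : S, exists U : set S, [/\ open U, U x &
        exists f : S -> R * R, homeomorphism_on U [set: R * R] f]].

(* A cell system records the vertices (as points), the open edges and the open
   faces; the closed cells are the topological closures. *)
Record cell_system (S : topologicalType) := CellSystem {
  vertices : set S;
  edges : set (set S);
  faces : set (set S) }.

Section Maps.
Variables (R : realType) (S : topologicalType) (M : cell_system S).

Definition open_arc (e : set S) : Prop :=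
  exists phi : R -> S,
    homeomorphism_on [set t : R | 0 <= t <= 1] (closure e) phi /\
    phi @` [set t | 0 < t < 1] = e.

Definition open_2cell (f : set S) : Prop :=
  exists h : R * R -> S,
    homeomorphism_on (closed_disc R) (closure f) h /\ h @` open_disc R = f.

Definition joins (e : set S) (u v : S) : Prop :=
  [/\ edges M e, vertices M u, vertices M v & closure e `\` e = [set u; v]].

(* The face [f] is the polygon [p_0, ..., p_(n-1)]: its frontier is the union
   of closed edges joining cyclically consecutive vertices of [p]. *)
Definition bounded_by (f : set S) (p : seq S) : Prop :=
  [/\ faces M f, uniq p &
      exists e : S -> set S,
        (forall u, u \in p -> joins (e u) u (next p u)) /\
        closure f `\` f = \bigcup_(u in [set` p]) closure (e u)].

Definition ngon (n : nat) (f : set S) : Prop :=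
  exists p : seq S, size p = n /\ bounded_by f p.

(* Decomposition of [S] into finitely many cells; every closed face is a disc
   bounded by a cycle of edges, as is standard for polyhedral maps. *)
Definition is_map : Prop :=
  [/\ [/\ finite_set (vertices M), finite_set (edges M) &
          finite_set (faces M)],
      forall e, edges M e -> open_arc e /\ exists u v, joins e u v,
      forall f, faces M f -> open_2cell f /\ exists n, ngon n f,
      [/\ trivIset (edges M) id, trivIset (faces M) id,
          vertices M `&` \bigcup_(e in edges M) e = set0,
          vertices M `&` \bigcup_(f in faces M) f = set0 &
          \bigcup_(e in edges M) e `&` \bigcup_(f in faces M) f = set0] &
      vertices M `|` \bigcup_(e in edges M) e `|` \bigcup_(f in faces M) f
        = [set: S]].

Definition polyhedral : Prop :=
  forall f g, faces M f -> faces M g -> f <> g ->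
    closure f `&` closure g !=set0 ->
    (exists2 v, vertices M v & closure f `&` closure g = [set v]) \/
    (exists2 e, edges M e & closure f `&` closure g = closure e).

(* At every vertex [u], the faces containing [u] are, without repetition,
   f_0, ..., f_(k-1), where f_i is a t_i-gon, and consecutive faces meet along
   pairwise distinct edges e_0, ..., e_(k-1) at [u]: they form a cycle of
   length k in the dual graph. The type [3^4, 10^1] is
   [t = [:: 3; 3; 3; 3; 10]]. *)
Definition semi_equivelar (t : seq nat) : Prop :=
  forall u, vertices M u ->
    exists (f e : 'I_(size t) -> set S),
      [/\ injective f, injective e,
          forall g, (faces M g /\ closure g u) <-> (exists i, g = f i),
          forall i : 'I_(size t), ngon (nth 0%N t i) (f i) &
          forall i, [/\ edges M (e i), closure (e i) u &
            closure (e i) `<=` closure (f i) `&` closure (f (ordS i))]].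

(* The Euler characteristic of the underlying surface, computed from the
   cell decomposition. *)
Definition euler_char : int :=
  #|` fset_set (vertices M)|%:Z - #|` fset_set (edges M)|%:Z
  + #|` fset_set (faces M)|%:Z.

End Maps.

(* Combinatorial data of a map: vertex set, adjacency along edges, and the
   cyclic vertex sequences of the faces (listed from any starting point and in
   either direction). *)
Record vertex_scheme (T : Type) := VertexScheme {
  sc_vertex : set T;
  sc_edge : T -> T -> Prop;
  sc_face : seq T -> Prop }.

Definition scheme_of_map (S : topologicalType) (M : cell_system S) :
    vertex_scheme S :=
  VertexScheme (vertices M) (fun u v => exists e, joins M e u v)
               (fun p => exists f, bounded_by M f p).

Definition scheme_of_faces (T : eqType) (V : set T) (F : seq (seq T)) :
    vertex_scheme T :=
  VertexScheme V
    (fun u v => exists2 q, q \in F &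
       (u \in q) && (next q u == v) || (v \in q) && (next q v == u))
    (fun p => exists2 q, q \in F &
       exists k, p = rot k q \/ p = rot k (rev q)).

Definition scheme_iso (T U : eqType) (A : vertex_scheme T) (B : vertex_scheme U) :
    Prop :=
  exists phi : T -> U,
    [/\ set_bij (sc_vertex A) (sc_vertex B) phi,
        forall u v, sc_vertex A u -> sc_vertex A v ->
          (sc_edge A u v <-> sc_edge B (phi u) (phi v)) &
        forall p, (forall u, u \in p -> sc_vertex A u) ->
          (sc_face A p <-> sc_face B (map phi p))].

Local Open Scope nat_scope.

Definition succ10 (i : nat) : nat := if i %% 10 == 0 then i - 9 else i.+1.

(* The involution swapping the two members of each pair (identity elsewhere). *)
Definition pairing (ps : seq (nat * nat)) (i : nat) : nat :=
  foldr (fun ij k => if i == ij.1 then ij.2 else if i == ij.2 then ij.1 else k)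
        i ps.

(* Every orbit of i |-> succ10 (sigma i) has size 3; each orbit triangle is
   listed three times below, once from each of its vertices. *)
Definition K_faces (ps : seq (nat * nat)) : seq (seq nat) :=
  [:: iota 1 10; iota 11 10; iota 21 10]
  ++ flatten [seq [:: [:: ij.1; succ10 ij.1; ij.2];
                      [:: ij.1; ij.2; succ10 ij.2]] | ij <- ps]
  ++ [seq traject (fun j => succ10 (pairing ps j)) i 3 | i <- iota 1 30].

Definition K_map (ps : seq (nat * nat)) : vertex_scheme nat :=
  scheme_of_faces [set i | 1 <= i <= 30] (K_faces ps).

Definition K1 : vertex_scheme nat := K_map
  [:: (1,30); (3,22); (5,26); (7,28); (9,24); (2,13); (4,19); (6,15); (8,17);
      (10,11); (12,23); (14,29); (16,25); (18,27); (20,21)].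

Definition K2 : vertex_scheme nat := K_map
  [:: (1,30); (3,24); (5,28); (7,22); (9,26); (2,13); (4,15); (6,17); (8,19);
      (10,11); (12,25); (14,29); (16,23); (18,27); (20,21)].

Definition K3 : vertex_scheme nat := K_map
  [:: (1,30); (3,26); (5,22); (7,24); (9,28); (2,13); (4,17); (6,19); (8,15);
      (10,11); (12,27); (14,29); (16,23); (18,25); (20,21)].

Definition K4 : vertex_scheme nat := K_map
  [:: (1,30); (3,22); (5,24); (7,26); (9,28); (2,15); (4,19); (6,13); (8,17);
      (10,11); (12,27); (14,23); (16,29); (18,25); (20,21)].

(* Main.v *)
(* Incidence counts and chi = -2 force 30 vertices and three disjoint 10-gons.
   Let the neighbours of u be, in cyclic order, s u, a u, b u, c u, s' u, where
   s and s' run around the 10-gon at u. The triangle on a 10-gon edge {u, s u}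
   has apex a u, and no vertex w is an apex twice, since then b w would have
   degree 3; hence every vertex is an apex exactly once. The 10-gon edge facing
   w is {a w, b w} or {b w, c w}; the same alternative holds all along a 10-gon,
   so reversing some 10-gons we may assume the former everywhere. Then
   b = s a, c = a s', a is an involution (the sigma of the four maps), and the
   triangles without 10-gon edges are the orbits of s a, so (s a)^3 = 1.
   Labelling the vertices from a base point, a finite search finds eight
   such involutions, each of them conjugate to that of K_1 or of K_4 (K_3 is in
   fact isomorphic to K_1, and K_2 to K_4). *)

(* The argument about links is run on [snub_links], a record of functions on a finite type that
   mentions no cells. It treats the two directions around a 10-gon alike, so reversing some 10-gons
   yields a second instance of the record instead of a second argument. The obstacle on the cell
   side is that [semi_equivelar] exhibits five edges at a vertex without saying that there are no
   others. The inequality [2 #E >= 5 #V] is all that is available at first; the count with chi = -2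
   makes it tight, and tightness gives degree exactly 5. The search is small because its first
   choices are forced: the labels 1, 21, 11 are given to an orbit of [s a], and (s a)^3 = 1 then
   prescribes on which 10-gon each mate lies. Its correctness asks only that the true involution is
   never pruned; the tables it returns are compared with the two targets by computation. *)
Require Import Defs.
From mathcomp Require Import all_boot all_order all_algebra.
From mathcomp Require Import finmap zify.
From mathcomp Require Import all_classical all_reals all_analysis.

Set Implicit Arguments.
Unset Strict Implicit.
Unset Printing Implicit Defensive.

Import Order.TTheory GRing.Theory Num.Theory.

(** * Links around the 10-gons *)

(** [D u] stands for the 10-gon at [u] and [tri x y z] for a triangular face. Exchanging [s] with
    [s'] and [a] with [c] preserves the axioms, even when done on some 10-gons only. *)
Record snub_links (T : finType) (K : Type) (D : T -> K) (tri : T -> T -> T -> Prop)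
    (s s' a b c : T -> T) : Prop := SnubLinks {
  succK : cancel s s';
  predK : cancel s' s;
  succ_period : forall u, iter 10 s u = u;
  succ_free : forall u k, 0 < k < 10 -> iter k s u <> u;
  D_succ : forall u, D (s u) = D u;
  D_a : forall u, D (a u) <> D u;
  D_b : forall u, D (b u) <> D u;
  D_c : forall u, D (c u) <> D u;
  link_uniq : forall u, uniq [:: s u; a u; b u; c u; s' u];
  tri_swap12 : forall x y z, tri x y z -> tri y x z;
  tri_swap23 : forall x y z, tri x y z -> tri x z y;
  tri_sa : forall u, tri u (s u) (a u);
  tri_ab : forall u, tri u (a u) (b u);
  tri_bc : forall u, tri u (b u) (c u);
  tri_cs : forall u, tri u (c u) (s' u);
  tri_link : forall u x y, tri u x y ->
    (x, y) \in [:: (s u, a u); (a u, b u); (b u, c u); (c u, s' u);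
                   (a u, s u); (b u, a u); (c u, b u); (s' u, c u)] }.

Section SnubLinks.
Variables (T : finType) (K : Type) (D : T -> K) (tri : T -> T -> T -> Prop).
Variables (s s' a b c : T -> T).
Hypothesis H : snub_links D tri s s' a b c.

Let neq5 u : [/\ [/\ s u <> a u, s u <> b u, s u <> c u & s u <> s' u],
  [/\ a u <> b u, a u <> c u & a u <> s' u] &
  [/\ b u <> c u, b u <> s' u & c u <> s' u]].
Proof.
have := link_uniq H u; rewrite /= !inE !negb_or -!andbA.
by case/and5P => /eqP ? /eqP ? /eqP ? /eqP ? /and5P[/eqP ? /eqP ? /eqP ? /eqP ? /and3P[/eqP ? /eqP ? _]].
Qed.

Ltac link_cases Ht := move: (tri_link H Ht); rewrite !inE !xpair_eqE;
  move=> /or4P[| | |/or4P[| | |/orP[]]] => /andP[/eqP ? /eqP ?].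

Lemma link_s u x : tri u (s u) x -> x = a u.
Proof. case: (neq5 u) => -[? ? ? ?] [? ? ?] [? ? ?] Ht; link_cases Ht; congruence. Qed.

Lemma link_s' u x : tri u (s' u) x -> x = c u.
Proof. case: (neq5 u) => -[? ? ? ?] [? ? ?] [? ? ?] Ht; link_cases Ht; congruence. Qed.

Lemma link_a u x : tri u (a u) x -> x = s u \/ x = b u.
Proof. case: (neq5 u) => -[? ? ? ?] [? ? ?] [? ? ?] Ht; link_cases Ht; intuition congruence. Qed.

Lemma link_c u x : tri u (c u) x -> x = b u \/ x = s' u.
Proof. case: (neq5 u) => -[? ? ? ?] [? ? ?] [? ? ?] Ht; link_cases Ht; intuition congruence. Qed.

Let D_pred u : D (s' u) = D u.
Proof. by rewrite -{2}(predK H u) (D_succ H). Qed.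

(** The triangle on [{u, s u}], seen from [s u], is the one on the predecessor side. *)
Lemma c_succ u : c (s u) = a u.
Proof.
symmetry; apply: link_s'; rewrite (succK H); apply: (tri_swap12 H); exact: (tri_sa H).
Qed.

Lemma a_pred u : a (s' u) = c u.
Proof. by rewrite -[in RHS](predK H u) c_succ. Qed.

Definition adj (x y : T) := (y == s x) || (x == s y).

Lemma adjC x y : adj x y = adj y x. Proof. by rewrite /adj orbC. Qed.

Lemma adj_s x y : adj x y -> y = s x \/ y = s' x.
Proof. by case/orP => /eqP ->; [left|right; rewrite (succK H)]. Qed.

(* Otherwise [b u] would have degree 3. *)
Lemma not_two_apexes u : adj (a u) (b u) -> adj (b u) (c u) -> False.
Proof.
rewrite adjC => /adj_s h1 /adj_s h2.
have t1 : tri (b u) (a u) u.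
  by apply: (tri_swap23 H); apply: (tri_swap12 H); apply: (tri_swap23 H); apply: (tri_ab H).
have t2 : tri (b u) (c u) u.
  by apply: (tri_swap23 H); apply: (tri_swap12 H); apply: (tri_bc H).
have [_ [_ ac _] _] := neq5 u; have [_ [_ ac' _] _] := neq5 (b u).
(* [a u] and [c u] are the two 10-gon neighbours of [b u], and [u] completes both triangles, so [u]
   is at once [a (b u)] and [c (b u)]. *)
case: h1 h2 => e1 [] e2; try congruence; rewrite e1 in t1; rewrite e2 in t2.
  by apply: ac'; rewrite -(link_s t1) -(link_s' t2).
by apply: ac'; rewrite -(link_s' t1) -(link_s t2).
Qed.

(** As [s w] and [s' w] lie on the 10-gon of [w], the edge [{u, s u}] in the link of [w] avoids
    both; two link edges remain, each in two directions. *)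
Lemma apex_link w u : tri w u (s u) -> D u <> D w ->
  [\/ u = a w /\ s u = b w, u = b w /\ s u = a w,
      u = b w /\ s u = c w | u = c w /\ s u = b w].
Proof.
move=> Ht Dw; have Ds := D_succ H u; have Ds' := D_succ H w.
have Ds'' := D_pred w.
link_cases Ht; solve [exfalso; congruence | by constructor 1 | by constructor 2 | by constructor 3 | by constructor 4].
Qed.

Lemma D_succ_neq u w : a u = w -> D u <> D w.
Proof. by move=> <- /esym; apply: (D_a H). Qed.

(* [a u] is the apex of the triangle on the edge [{u, s u}]. *)
Lemma a_inj : injective a.
Proof.
have tw u w : a u = w -> tri w u (s u).
  move=> <-; apply: (tri_swap12 H); apply: (tri_swap23 H); exact: (tri_sa H).
move=> u v euv; pose w := a u.
have := apex_link (tw u w erefl) (D_succ_neq (erefl w)).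
have := apex_link (tw v w (esym euv)) (D_succ_neq (esym euv : a v = w)).
have no2 := @not_two_apexes w.
have free2 x y : x = s y -> y = s x -> False.
  move=> exy eyx; apply: (succ_free H (u := x) (k := 2)) => //=.
  by rewrite -eyx -exy.
have sI := can_inj (succK H).
have ad x y z : x = y -> s x = z -> adj y z by rewrite /adj => -> ->; rewrite eqxx.
(* The edges at [u] and [v] either coincide, or are one edge run both ways, which gives [s] a
   2-cycle, or are the two edges that [no2] forbids together. *)
case=> -[e1 e2] []; case=> -[e3 e4]; try congruence;
  try (exfalso; apply: (free2 u v); congruence);
  exfalso; apply: no2; first [exact: ad e1 e2 | exact: ad e3 e4
    | by rewrite adjC; exact: ad e1 e2 | by rewrite adjC; exact: ad e3 e4].
Qed.

(** Being injective on a finite type, [a] is onto, so every [w] is the apex of some 10-gon edge. *)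
Lemma one_apex w : adj (a w) (b w) || adj (b w) (c w).
Proof.
have [a' a'K aK] := injF_bij a_inj.
have tw : tri w (a' w) (s (a' w)).
  rewrite -{1}(aK w); apply: (tri_swap12 H); apply: (tri_swap23 H); exact: (tri_sa H).
have := apex_link tw (D_succ_neq (aK w)).
by rewrite /adj; case => -[<- <-]; rewrite eqxx ?orbT.
Qed.

Definition forward w := adj (a w) (b w).

(* Otherwise [a w] would have degree 4. *)
Lemma forward_succ w : forward w -> forward (s w).
Proof.
move=> fw; apply: contraT => nfw; exfalso.
have := one_apex (s w); rewrite -/(forward _) (negbTE nfw) /= c_succ.
move: fw; rewrite /forward; set x := a w => ad1; rewrite adjC => ad2.
have t1 : tri x (b w) w.
  by apply: (tri_swap23 H); apply: (tri_swap12 H); apply: (tri_ab H).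
have t2 : tri x (b (s w)) (s w).
  apply: (tri_swap23 H); apply: (tri_swap12 H); apply: (tri_swap23 H).
  rewrite /x -c_succ; exact: (tri_bc H).
have t3 : tri x w (s w).
  apply: (tri_swap12 H); apply: (tri_swap23 H); exact: (tri_sa H).
have nws : w <> s w by move=> e; apply: (succ_free H (u := w) (k := 1)).
have [[? ? ? ?] [? ? ?] [? ? ?]] := neq5 x.
(* Both [b w] and [b (s w)] are 10-gon neighbours of [x]. On the same side they force [w = s w]; on
   opposite sides [w] and [s w] are [a x] and [c x] in some order, which [t3] would make consecutive
   in the link of [x]. *)
case: (adj_s ad1) (adj_s ad2) => e1 [] e2; rewrite e1 in t1; rewrite e2 in t2.
- by apply: nws; rewrite [LHS](link_s t1) [RHS](link_s t2).
- rewrite (link_s' t2) [w](link_s t1) in t3; case: (link_a t3); congruence.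
- rewrite (link_s t2) [w](link_s' t1) in t3; case: (link_c t3); congruence.
- by apply: nws; rewrite [LHS](link_s' t1) [RHS](link_s' t2).
Qed.

Lemma forward_succE w : forward (s w) = forward w.
Proof.
apply/idP/idP; last exact: forward_succ.
(* Backwards by going round: [w] is nine steps after [s w]. *)
move=> fw; rewrite -(succ_period H w) iterSr.
by elim: 9 => [|n IHn]; rewrite ?iter0 // iterS; apply: forward_succ.
Qed.

Lemma forward_predE w : forward (s' w) = forward w.
Proof. by rewrite -{2}(predK H w) forward_succE. Qed.

(** Reverse exactly the 10-gons whose vertices are not [forward]; this is consistent because
    [forward] is constant along each 10-gon. *)
Definition turn_succ u := if forward u then s u else s' u.
Definition turn_pred u := if forward u then s' u else s u.
Definition turn_a u := if forward u then a u else c u.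
Definition turn_c u := if forward u then c u else a u.

Lemma iter_turn_succ k u : iter k turn_succ u = if forward u then iter k s u else iter k s' u.
Proof.
elim: k u => [|k IHk] u; first by case: ifP.
rewrite !iterSr IHk /turn_succ; case: (boolP (forward u)) => fu.
  by rewrite forward_succE fu.
by rewrite forward_predE (negbTE fu).
Qed.

Lemma iter_predK k : cancel (iter k s) (iter k s').
Proof. by elim: k => // k IHk u; rewrite iterSr [iter k.+1 s u]iterS (succK H) IHk. Qed.

Lemma iter_succK k : cancel (iter k s') (iter k s).
Proof. by elim: k => // k IHk u; rewrite iterSr [iter k.+1 s' u]iterS (predK H) IHk. Qed.

Lemma turn_snub_links : snub_links D tri turn_succ turn_pred turn_a b turn_c.
Proof.
split; try by [exact: (D_b H)|exact: (tri_swap12 H)|exact: (tri_swap23 H)].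
- move=> u; rewrite /turn_pred /turn_succ; case: (boolP (forward u)) => fu.
    by rewrite forward_succE fu (succK H).
  by rewrite forward_predE (negbTE fu) (predK H).
- move=> u; rewrite /turn_pred /turn_succ; case: (boolP (forward u)) => fu.
    by rewrite forward_predE fu (predK H).
  by rewrite forward_succE (negbTE fu) (succK H).
- move=> u; rewrite iter_turn_succ (succ_period H); case: ifP => // _.
  by rewrite -{1}(succ_period H u) iter_predK.
- move=> u k hk; rewrite iter_turn_succ; case: ifP => _; first exact: (succ_free H).
  by move=> e; apply: (succ_free H (u := u) hk); rewrite -{1}e iter_succK.
- by move=> u; rewrite /turn_succ; case: ifP => _; rewrite ?D_pred ?(D_succ H).
- by move=> u; rewrite /turn_a; case: ifP => _; [exact: (D_a H)|exact: (D_c H)].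
- by move=> u; rewrite /turn_c; case: ifP => _; [exact: (D_c H)|exact: (D_a H)].
- move=> u; rewrite /turn_a /turn_c /turn_succ /turn_pred; have := link_uniq H u.
  by case: ifP => // _; rewrite -rev_uniq.
- move=> u; rewrite /turn_succ /turn_a; case: ifP => _; first exact: (tri_sa H).
  by apply: (tri_swap23 H); apply: (tri_cs H).
- move=> u; rewrite /turn_a; case: ifP => _; first exact: (tri_ab H).
  by apply: (tri_swap23 H); apply: (tri_bc H).
- move=> u; rewrite /turn_c; case: ifP => _; first exact: (tri_bc H).
  by apply: (tri_swap23 H); apply: (tri_ab H).
- move=> u; rewrite /turn_pred /turn_c; case: ifP => _; first exact: (tri_cs H).
  by apply: (tri_swap23 H); apply: (tri_sa H).
- move=> u x y Ht; rewrite /turn_a /turn_c /turn_succ /turn_pred.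
  have := tri_link H Ht; case: ifP => // _; rewrite !inE.
  by move=> /or4P[| | |/or4P[| | |/orP[]]] => ->; rewrite ?orbT.
Qed.

(** The direction of this edge along its own 10-gon stays open here; [b_succ_a] settles it. *)
Lemma turn_forward u :
  (b u == turn_succ (turn_a u)) || (turn_a u == turn_succ (b u)).
Proof.
have E x y : adj x y -> (y == turn_succ x) || (x == turn_succ y).
  by rewrite /turn_succ /adj; case/orP => /eqP ->;
    rewrite forward_succE; case: ifP; rewrite ?(succK H) ?eqxx ?orbT.
apply: E; rewrite /turn_a; case: (boolP (forward u)) => // nf.
by rewrite adjC; have := one_apex u; rewrite -/(forward u) (negbTE nf).
Qed.

End SnubLinks.

(** * Relations between the link functions of consistently oriented 10-gons *)

Section Forward.
Variables (T : finType) (K : Type) (D : T -> K) (tri : T -> T -> T -> Prop).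
Variables (s s' a b c : T -> T).
Hypothesis H : snub_links D tri s s' a b c.
Hypothesis all_forward : forall u, adj s (a u) (b u).

(** If [a u = s (b u)] instead, then [u = c (a u)] and [s u = b (a u)], so [a u] faces the edge
    [{u, s u}] on its [c] side besides the edge on its [a] side, against [not_two_apexes]. *)
Lemma b_succ_a u : b u = s (a u).
Proof.
have /orP[/eqP //|/eqP e] := all_forward u; exfalso.
have := tri_ab H u; rewrite e => t1.
have e1 : u = a (b u).
  by apply: (link_s H); apply: (tri_swap23 H); apply: (tri_swap12 H); apply: (tri_swap23 H).
have e2 : c (s (b u)) = u by rewrite (c_succ H).
have t2 : tri (s (b u)) (c (s (b u))) (s u).
  rewrite e2 -e; apply: (tri_swap12 H); apply: (tri_swap23 H); exact: (tri_sa H).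
have := all_forward (s (b u)); have := link_c H t2.
rewrite (succK H) => -[e3|e3].
  move=> ad; apply: (not_two_apexes H ad); by rewrite -e3 e2 /adj eqxx orbT.
by move: (link_uniq H u); rewrite /= !inE e3 eqxx !orbT.
Qed.

(** The edge [{a u, s (a u)}] is the one facing [u], so its apex is [u]. *)
Lemma a_involutive : involutive a.
Proof.
move=> u; symmetry; apply: (link_s H).
by rewrite -b_succ_a; apply: (tri_swap23 H); apply: (tri_swap12 H); apply: (tri_ab H).
Qed.

(** Look at the triangle [{u, b u, c u}] from [b u]: since [s' (b u) = a u], the vertex [u] is
    [c (b u)], so the third vertex [c u] is [b (b u)], the other choice [a u] being excluded. With
    [b = s a] and [c = a s'] this is the claim. *)
Lemma succ_a_period3 u : s (a (s (a (s (a u))))) = u.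
Proof.
suff E : s (a (s (a u))) = a (s' u) by rewrite E a_involutive (predK H).
rewrite -!b_succ_a (a_pred H).
have t : tri (b u) (a (s' (b u))) (c u).
  have -> : a (s' (b u)) = u by rewrite b_succ_a (succK H) a_involutive.
  by apply: (tri_swap12 H); apply: (tri_bc H).
rewrite (a_pred H) in t; have [->//|e] := link_c H t.
have e' : c u = a u by rewrite e b_succ_a (succK H).
by move: (link_uniq H u); rewrite /= !inE e' eqxx !orbT !andbF.
Qed.

End Forward.

(** * Search for the involution *)

Definition pairs1 : seq (nat * nat) :=
  [:: (1,30); (3,22); (5,26); (7,28); (9,24); (2,13); (4,19); (6,15); (8,17);
      (10,11); (12,23); (14,29); (16,25); (18,27); (20,21)].

Definition pairs4 : seq (nat * nat) :=
  [:: (1,30); (3,22); (5,24); (7,26); (9,28); (2,15); (4,19); (6,13); (8,17);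
      (10,11); (12,27); (14,23); (16,29); (18,25); (20,21)].

Definition labels := iota 1 30.
Arguments labels : simpl never.
Definition color i := i.-1 %/ 10.

(* Tables list the pairs (i, g i) known so far; 0 stands for an unknown value. *)
Definition lookup (l : seq (nat * nat)) i :=
  foldr (fun p k => if p.1 == i then p.2 else k) 0 l.

Definition period3_at l i :=
  let j := lookup l i in (j == 0) ||
  let k := lookup l (succ10 j) in (k == 0) ||
  let m := lookup l (succ10 k) in (m == 0) || (succ10 m == i).

(* The 10-gon containing the mate of [i]: it alternates along each 10-gon,
   since [u], [a u] and [a (s u)] lie in three different 10-gons. *)
Definition mate_color i := nth 0
  (nth [::] [:: [:: 2; 1]; [:: 0; 2]; [:: 1; 0]] (color i)) (i.-1 %% 2).

Definition may_pair l i j :=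
  [&& lookup l j == 0, mate_color i == color j & mate_color j == color i].

(** Backtracking on the first unmatched label. Testing the period at the two new entries only is
    harmless: a weaker test can only return more tables. *)
Fixpoint search (todo : seq nat) l := 
  if todo is i :: todo' then
    if lookup l i != 0 then search todo' l else
    flatten [seq (let l' := [:: (i, j), (j, i) & l] in
                  if period3_at l' i && period3_at l' j then search todo' l' else [::])
            | j <- labels & may_pair l i j]
  else [:: l].

(** These pairs say that [s a] sends 1 to 21, 21 to 11 and 11 to 1. They also give the even column
    of the table in [mate_color]. *)
Definition search_start := [:: (1, 30); (30, 1); (21, 20); (20, 21); (11, 10); (10, 11)].

(* The permutation commuting with [succ10] that sends 1, 11, 21 to the entries
   of [bs]. *)
Definition relabel (bs : seq nat) i := iter (i.-1 %% 10) succ10 (nth 0 bs (color i)).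

(** Each entry is a target involution with the images of 1, 11, 21 under a conjugation to it;
    [search_relabels] checks that every table found is covered. *)
Definition relabelings : seq (seq (nat * nat) * seq nat) :=
  [:: (pairs1, [:: 1; 11; 21]); (pairs1, [:: 5; 19; 27]); (pairs1, [:: 3; 13; 23]);
      (pairs1, [:: 2; 30; 14]); (pairs1, [:: 4; 22; 20]);
      (pairs4, [:: 1; 11; 21]); (pairs4, [:: 2; 30; 16]); (pairs4, [:: 11; 21; 1])].

Definition relabels l (r : seq (nat * nat) * seq nat) :=
  all (fun i => relabel r.2 (lookup l i) == pairing r.1 (relabel r.2 i)) labels.

Lemma search_relabels :
  all (fun l => has (relabels l) relabelings) (search labels search_start).
Proof. by vm_compute. Qed.

Lemma uniq_map_inj_in (A B : eqType) (f : A -> B) t : uniq (map f t) -> {in t &, injective f}.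
Proof.
move=> u x y hx hy e; apply/eqP; rewrite -(nth_index x hx) -(nth_index x hy).
rewrite nth_uniq ?index_mem ?(map_uniq u) // -(nth_uniq (f x) _ _ u) ?size_map ?index_mem //.
by rewrite !(nth_map x) ?index_mem // !nth_index // e.
Qed.

Lemma in_labels i : (i \in labels) = (0 < i < 31).
Proof. by rewrite mem_iota. Qed.

Lemma labelsW (P : pred nat) : all P labels -> forall i, i \in labels -> P i.
Proof. by move/allP. Qed.

Lemma labels_succ i : i \in labels -> succ10 i \in labels.
Proof. by apply: (labelsW (P := fun j => succ10 j \in labels)); vm_compute. Qed.

Section SearchSound.
Variable g : nat -> nat.
Hypothesis g_labels : forall i, i \in labels -> g i \in labels.
Hypothesis gK : forall i, i \in labels -> g (g i) = i.
Hypothesis g_period : forall i, i \in labels ->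
  succ10 (g (succ10 (g (succ10 (g i))))) = i.
Hypothesis g_color : forall i, i \in labels -> mate_color i = color (g i).

Definition agrees (l : seq (nat * nat)) := all (fun p => g p.1 == p.2) l.

Lemma lookup_agrees l i : agrees l -> lookup l i = 0 \/ lookup l i = g i.
Proof.
elim: l => [|[x y] l IHl] /=; first by left.
by case/andP => /eqP exy /IHl; case: eqP => [<-|] //; right.
Qed.

Lemma agrees_period l i : agrees l -> i \in labels -> period3_at l i.
Proof.
move=> al hi; rewrite /period3_at; have hg := g_labels hi.
case: (lookup_agrees i al) => ->; first by [].
case: (lookup_agrees (succ10 (g i)) al) => ->; first by rewrite eqxx orbT.
case: (lookup_agrees (succ10 (g (succ10 (g i)))) al) => ->; first by rewrite eqxx !orbT.
by rewrite g_period // eqxx !orbT.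
Qed.

Lemma search_cons i todo l : search (i :: todo) l =
  if lookup l i != 0 then search todo l else
  flatten [seq (let l' := [:: (i, j), (j, i) & l] in
                if period3_at l' i && period3_at l' j then search todo l' else [::])
          | j <- labels & may_pair l i j].
Proof. by []. Qed.

(** Ensures that the mate of an unmatched label is still free, as [may_pair] demands. *)
Definition mate_closed l := forall i, i \in labels -> lookup l i = 0 -> lookup l (g i) = 0.

(** Follow the branch that pairs each label with its image under [g]: a table agreeing with [g]
    passes every test, so this branch survives. *)
Lemma search_sound todo l : {subset todo <= labels} -> agrees l -> mate_closed l ->
  exists2 l', l' \in search todo l & agrees l' /\
    forall i, (i \in todo) || (lookup l i != 0) -> lookup l' i = g i.
Proof.
elim: todo l => [|i todo IHtodo] l sub al cl.
  exists l; rewrite ?inE //; split=> // i /=.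
  by case: (lookup_agrees i al) => ->.
have hi : i \in labels by apply: sub; rewrite mem_head.
have sub' : {subset todo <= labels} by move=> x hx; apply: sub; rewrite inE hx orbT.
rewrite search_cons; case: ifP => [li|/negbFE/eqP li].
  have [l' l'in [al' hl']] := IHtodo l sub' al cl.
  exists l' => //; split=> // x; rewrite inE => /orP[/orP[/eqP ->|hx]|hx];
    by apply: hl'; rewrite ?li ?hx ?orbT.
have hj := g_labels hi; set j := g i in hj *.
pose l1 := [:: (i, j), (j, i) & l].
have al1 : agrees l1 by rewrite /agrees /= eqxx gK // eqxx.
have gt0 x : x \in labels -> x != 0 by rewrite in_labels; case: x.
have cl1 : mate_closed l1.
  move=> x hx; rewrite /l1 /=; case: eqP => [_|nix]; first by move/eqP; rewrite (negbTE (gt0 _ hj)).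
  case: eqP => [_|njx]; first by move/eqP; rewrite (negbTE (gt0 _ hi)).
  move=> /(cl x hx) ->; case: eqP => [e|_]; first by case: njx; rewrite /j e gK.
  by case: eqP => // e; case: nix; rewrite -(gK hi) -/j e gK.
have [l' l'in [al' hl']] := IHtodo l1 sub' al1 cl1.
exists l'; last first.
  split=> // x; rewrite inE => hx; apply: hl' => /=.
  case: (i =P x) hx => [<-|/eqP nix] hx; first by rewrite gt0 ?orbT.
  rewrite eq_sym (negbTE nix) /= in hx.
  by case: (j =P x) => // _; rewrite gt0 ?orbT.
apply/flattenP; exists (search todo l1) => //.
apply/mapP; exists j; last by cbv zeta; rewrite -/l1 !agrees_period.
rewrite mem_filter hj andbT /may_pair (g_color hi) eqxx (g_color hj) /j (gK hi) eqxx.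
by rewrite cl.
Qed.

Hypotheses (g1 : g 1 = 30) (g21 : g 21 = 20) (g11 : g 11 = 10).

Lemma relabels_g : exists2 r, r \in relabelings &
  forall i, i \in labels -> relabel r.2 (g i) = pairing r.1 (relabel r.2 i).
Proof.
have [g30 g20 g10] : [/\ g 30 = 1, g 20 = 21 & g 10 = 11] 
  by split; [rewrite -g1|rewrite -{1}g21|rewrite -{1}g11]; rewrite gK ?in_labels.
have al : agrees search_start by rewrite /agrees /= g1 g21 g11 g30 g20 g10.
have cl : mate_closed search_start.
  pose keys := [:: 1; 30; 21; 20; 11; 10].
  have keysE x : (lookup search_start x == 0) = (x \notin keys).
    by rewrite /keys !inE /= !(eq_sym x); do 6 (case: (_ =P x) => //= _).
  have g_keys x : x \in keys -> g x \in keys.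
    by rewrite {1}/keys !inE; do ![case/predU1P => [->|]] => [|||||/eqP ->];
      rewrite ?g1 ?g21 ?g11 ?g30 ?g20 ?g10.
  move=> i hi /eqP; rewrite keysE => ik; apply/eqP; rewrite keysE.
  by apply: contra ik => /g_keys; rewrite gK.
have [l lin [al' hl]] := search_sound (fun _ h => h) al cl.
have /hasP[r rin /allP hr] := allP search_relabels l lin.
exists r; first exact: rin.
by move=> i hi; have := eqP (hr i hi); rewrite hl ?hi.
Qed.

End SearchSound.

Lemma relabel_ok r : r \in relabelings ->
  [/\ forall i, i \in labels -> relabel r.2 i \in labels,
     forall i, i \in labels -> relabel r.2 (succ10 i) = succ10 (relabel r.2 i),
     {in labels &, injective (relabel r.2)} & r.1 = pairs1 \/ r.1 = pairs4].
Proof.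
have H : all (fun r => [&& all (fun i => relabel r.2 i \in labels) labels,
  all (fun i => relabel r.2 (succ10 i) == succ10 (relabel r.2 i)) labels,
  uniq (map (relabel r.2) labels) & (r.1 == pairs1) || (r.1 == pairs4)]) relabelings.
  by vm_compute.
move=> /(allP H)/and4P[/allP h1 /allP h2 h3 h4]; split.
- exact: h1.
- by move=> i /h2/eqP.
- exact: uniq_map_inj_in.
- by case/orP: h4 => /eqP ->; [left|right].
Qed.

(** * Labelling of the vertices *)

Section Labeling.
Variables (T : finType) (K : Type) (D : T -> K) (tri : T -> T -> T -> Prop).
Variables (s s' a b c : T -> T).
Hypothesis H : snub_links D tri s s' a b c.
Hypothesis all_forward : forall u, adj s (a u) (b u).
Hypothesis card_T : #|T| = 30.

Let aK := a_involutive H all_forward.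
Let period3 := succ_a_period3 H all_forward.
Let sI : injective s := can_inj (succK H).

Let a_s_a_s u : s (a (s (a (s u)))) = a u.
Proof. by have := period3 (a u); rewrite aK. Qed.

(** Put [v = s (a (s u))]. Then [a u = s (a v)] is on the 10-gon of [a v], while [a (s u)] is on
    that of [v]. *)
Let D_a_s_a u : D (a (s u)) <> D (a u).
Proof. by move=> e; apply: (D_a H (u := s (a (s u)))); rewrite -(D_succ H) a_s_a_s (D_succ H). Qed.

Lemma labeling : exists (phi : T -> nat) ps,
  [/\ ps = pairs1 \/ ps = pairs4, injective phi, forall u, phi u \in labels,
      forall u, phi (s u) = succ10 (phi u) & forall u, phi (a u) = pairing ps (phi u)].
Proof.
have /card_gt0P[u0 _] : 0 < #|T| by rewrite card_T.
(* In the order of the labels 1, 11, 21, which makes [a] match [search_start]. The three lie on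
   different 10-gons, so running along these gives 30 distinct vertices, hence all. *)
pose bases := [:: u0; s (a (s (a u0))); s (a u0)].
pose psi i := iter (i.-1 %% 10) s (nth u0 bases (color i)).
have psi_succ i : i \in labels -> psi (succ10 i) = s (psi i).
  have /allP P : all (fun i => (color (succ10 i) == color i) &&
      (if i.-1 %% 10 == 9 then (succ10 i).-1 %% 10 == 0
       else (succ10 i).-1 %% 10 == (i.-1 %% 10).+1)) labels by vm_compute.
  move=> /P /andP[/eqP e]; rewrite /psi e; case: eqP => [-> /eqP ->|_ /eqP ->] //.
  by rewrite -iterS (succ_period H).
have color_bound i : i \in labels -> color i < 3.
  by rewrite in_labels /color => /andP[i0 i31]; rewrite ltn_divLR //; case: i i0 i31.
have D_psi i : D (psi i) = D (nth u0 bases (color i)).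
  by rewrite /psi; elim: (_ %% _) => // n IHn; rewrite iterS (D_succ H).
have D_bases : [/\ D (nth u0 bases 0) <> D (nth u0 bases 1),
   D (nth u0 bases 1) <> D (nth u0 bases 2) & D (nth u0 bases 0) <> D (nth u0 bases 2)].
  split=> /=; rewrite ?(D_succ H).
  - by move/esym; rewrite -{2}(aK u0); apply: D_a_s_a.
  - by rewrite -[D (a u0)](D_succ H); apply: (D_a H).
  - by move/esym; apply: (D_a H).
have D_color i j : i \in labels -> j \in labels -> D (psi i) = D (psi j) -> color i = color j.
  move=> /color_bound + /color_bound; rewrite !D_psi; case: D_bases.
  by move: (color i) (color j) => [|[|[|//]]] [|[|[|//]]] // ? ? ?; try congruence.
have color_D i j : color i = color j -> D (psi i) = D (psi j) by rewrite !D_psi => ->.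
have iterI k : injective (iter k s).
  by elim: k => // k IHk x y; rewrite !iterS => /sI/IHk.
have psi_inj : {in labels &, injective psi}.
  move=> i j hi hj e; have ec := D_color i j hi hj (congr1 D e).
  suff er : i.-1 %% 10 = j.-1 %% 10.
    move: hi hj ec er; rewrite !in_labels /color; lia.
  move: e; rewrite /psi ec; set x := nth _ _ _.
  have fr m n : m < n < 10 -> iter m s x = iter n s x -> False.
    move=> /andP[mn n10]; rewrite -(subnKC (ltnW mn)) iterD => /iterI/esym.
    by apply: (succ_free H); lia.
  have := ltn_pmod i.-1 (isT : 0 < 10); have := ltn_pmod j.-1 (isT : 0 < 10).
  case: (ltngtP (i.-1 %% 10) (j.-1 %% 10)) => // h h1 h2 e; exfalso.
    by apply: (fr _ _ _ e); rewrite h ?h1 ?h2.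
  by apply: (fr _ _ _ (esym e)); rewrite h ?h1 ?h2.
pose L := map psi labels.
have uL : uniq L by rewrite (map_inj_in_uniq psi_inj) iota_uniq.
have inL u : u \in L.
  have e : #|L| = #|T| by rewrite (card_uniqP uL) size_map size_iota card_T.
  by rewrite (subset_cardP e (subset_predT _)).
pose lam u := (index u L).+1.
have lam_labels u : lam u \in labels by rewrite in_labels /= ltnS -[30](size_map psi labels) index_mem.
have lamK u : psi (lam u) = u.
  have ui : index u L < 30 by rewrite -[30](size_map psi labels) index_mem.
  by rewrite -[RHS](nth_index u0 (inL u)) (nth_map 0) ?size_iota // nth_iota.
have lam_inj : injective lam by exact: can_inj lamK.
have psiK i : i \in labels -> lam (psi i) = i by move=> hi; apply: psi_inj; rewrite ?lamK.
have lam_succ u : lam (s u) = succ10 (lam u).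
  rewrite -{1}(lamK u) -psi_succ; last exact: lam_labels.
  by rewrite psiK //; apply: labels_succ; apply: lam_labels.
clearbody lam.
pose g i := lam (a (psi i)); have g_def i : g i = lam (a (psi i)) by []; clearbody g.
have gE i : psi (g i) = a (psi i) by rewrite g_def lamK.
have g_labels i : i \in labels -> g i \in labels by move=> _; rewrite g_def; apply: lam_labels.
have gK i : i \in labels -> g (g i) = i by move=> hi; rewrite g_def gE aK psiK.
have g_period i : i \in labels -> succ10 (g (succ10 (g (succ10 (g i))))) = i.
  have gs j : j \in labels -> succ10 (g j) \in labels by move/g_labels/labels_succ.
  move=> hi; have h1 := gs _ hi; have h2 := gs _ h1; have h3 := gs _ h2.
  apply: psi_inj => //.
  have psg j : j \in labels -> psi (succ10 (g j)) = s (a (psi j)).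
    by move=> hj; rewrite psi_succ ?gE; last exact: g_labels.
  by rewrite (psg _ h2) (psg _ h1) (psg _ hi) period3.
have g1 : g 1 = 30.
  apply: psi_inj; rewrite ?g_labels ?in_labels // gE; apply: sI.
  by rewrite -psi_succ ?in_labels.
have g21 : g 21 = 20.
  apply: psi_inj; rewrite ?g_labels ?in_labels // gE; apply: sI.
  by rewrite -psi_succ ?in_labels.
have g11 : g 11 = 10.
  apply: psi_inj; rewrite ?g_labels ?in_labels // gE; apply: sI.
  by rewrite -psi_succ ?in_labels // [LHS]period3.
(* Of three 10-gons, the mate of [succ10 i] avoids that of [i] and that of [g i]; the table takes
   the remaining one too. *)
have g_step i : i \in labels -> mate_color i = color (g i) ->
    mate_color (succ10 i) = color (g (succ10 i)).
  have /allP P : all (fun i => [&& mate_color (succ10 i) < 3, mate_color (succ10 i) != color i,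
      mate_color i < 3, mate_color i != color i & mate_color (succ10 i) != mate_color i]) labels by vm_compute.
  move=> hi e; have hs := labels_succ hi.
  have c0 := color_bound _ hi; have c1 := color_bound _ (g_labels _ hs).
  have n1 : color (g (succ10 i)) <> color i.
    by move/color_D; rewrite gE (psi_succ _ hi) -(D_succ H (psi i)); apply: (D_a H).
  have n2 : color (g (succ10 i)) <> color (g i).
    by move/color_D; rewrite !gE (psi_succ _ hi); apply: D_a_s_a.
  move: (P i hi) n1 n2 c0 c1; rewrite e; move: (mate_color _) (color (g _)) (color (g _)) (color i).
  lia.
(* Every label is reached by [succ10] from 1, 11 or 21, whose mates are known. *)
have g_color i : i \in labels -> mate_color i = color (g i).
  have /allP P : all (fun i => [&& i == iter (i.-1 %% 10) succ10 (color i * 10).+1,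
     (color i * 10).+1 \in labels & color i < 3]) labels by vm_compute.
  move=> /P/and3P[/eqP e hb c3]; rewrite e.
  suff [//] : iter (i.-1 %% 10) succ10 (color i * 10).+1 \in labels /\
    mate_color (iter (i.-1 %% 10) succ10 (color i * 10).+1) = color (g (iter (i.-1 %% 10) succ10 (color i * 10).+1)).
  elim: (_ %% _) => [|n [IH1 IH2]] /=; last by split; [exact: labels_succ|exact: g_step].
  by split=> //; case: (color i) c3 => [|[|[|n]]] // _; rewrite ?g1 ?g11 ?g21.
have [r rin hr] := relabels_g g_labels gK g_period g_color g1 g21 g11.
have [r_labels r_succ r_inj r_pairs] := relabel_ok rin.
exists (relabel r.2 \o lam), r.1; split=> //= u.
- by move=> v /r_inj e; apply: lam_inj; apply: e.
- exact: r_labels.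
- by rewrite lam_succ r_succ.
- by rewrite -hr ?g_def ?lamK.
Qed.
End Labeling.

(** * Polygons up to rotation and reflection *)

Section Dihedral.
Variable T : eqType.
Implicit Types p q r : seq T.

Definition dihedral p q := exists k, p = rot k q \/ p = rot k (rev q).

Lemma rot_rot_ex j k q : exists m, rot k (rot j q) = rot m q.
Proof.
have [hj|/ltnW hj] := leqP j (size q); last by exists k; rewrite (rot_oversize hj).
have [hk|/ltnW hk] := leqP k (size q); last by exists j; rewrite (@rot_oversize _ k) ?size_rot.
by eexists; apply: rot_add_mod.
Qed.

Lemma dihedral_rot k q : dihedral (rot k q) q. Proof. by exists k; left. Qed.

Lemma dihedral_rev q : dihedral (rev q) q.
Proof. by exists 0; right; rewrite rot0. Qed.

Lemma dihedral_trans q p r : dihedral p q -> dihedral q r -> dihedral p r.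
Proof.
have rr k j (s : seq T) : exists m, rot k (rev (rot j s)) = rot m (rev s).
  by rewrite rev_rot /rotr; apply: rot_rot_ex.
case=> k pq [j qr]; case: pq qr => -> [] ->.
- by have [m ->] := rot_rot_ex j k r; exists m; left.
- by have [m ->] := rot_rot_ex j k (rev r); exists m; right.
- by have [m ->] := rr k j r; exists m; right.
- by have [m ->] := rr k j (rev r); exists m; left; rewrite revK.
Qed.

Lemma dihedral_sym p q : dihedral p q -> dihedral q p.
Proof.
case=> k [] ->; first by rewrite -{1}(rotK k q) /rotr; apply: dihedral_rot.
apply: (@dihedral_trans (rev q)); first by exists 0; right; rewrite rot0 revK.
by rewrite -{1}(rotK k (rev q)) /rotr; apply: dihedral_rot.
Qed.

Lemma traject_cycle (f : T -> T) p x : fcycle f p -> x \in p ->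
  iter (size p) f x = x /\ exists i, traject f x (size p) = rot i p.
Proof.
move=> fp px; have [i q E] := rot_to px.
move: fp; rewrite -(rot_cycle i) E -[size p](size_rot i) E /= => fq.
have := fq; rewrite rcons_path => /andP[/fpathE qE /eqP lE].
split; last by exists i; rewrite E [in RHS]qE.
by rewrite -[RHS]lE [in RHS]qE last_traject.
Qed.

(** Once the two cycles take a step together they never part: turning back at [y] would make
    [prev p y] and [y] a 2-cycle of [next p], impossible on more than two vertices. *)
Lemma next_fixed_dihedral p q x : uniq p -> uniq q -> p =i q -> 2 < size p -> x \in p ->
  (forall u, u \in p -> next p u = next q u \/ next p u = prev q u) ->
  next p x = next q x -> dihedral p q.
Proof.
move=> up uq pq p2 px hn e0.
have in_iter k : iter k (next p) x \in p by elim: k => // k IHk; rewrite iterS mem_next.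
have E k : iter k (next p) x = iter k (next q) x /\ iter k.+1 (next p) x = iter k.+1 (next q) x.
  elim: k => [|k [IH1 IH2]] //; split=> //.
  set y := iter k.+1 (next p) x; have yp : y \in p by apply: in_iter.
  rewrite iterS -/y [RHS]iterS -IH2 -/y; case: (hn y yp) => // ey; exfalso.
  have py : prev q y = prev p y.
    by rewrite {1}/y IH2 iterS (prev_next uq) -IH1 /y iterS (prev_next up).
  have : next p (next p (prev p y)) = prev p y by rewrite next_prev // ey py.
  set z := prev p y => ez.
  have zp : z \in p by rewrite mem_prev.
  have [_ [i ti]] := traject_cycle (cycle_next up) zp.
  have : uniq (traject (next p) z (size p)) by rewrite ti rot_uniq.
  by case: (size p) p2 => [|[|[|n]]] // _; rewrite !trajectS ez /= !inE eqxx !orbT.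
have sz : size p = size q by apply: perm_size; apply: uniq_perm.
have xq : x \in q by rewrite -pq.
have [_ [i ti]] := traject_cycle (cycle_next up) px.
have [_ [j tj]] := traject_cycle (cycle_next uq) xq.
have tt : traject (next p) x (size p) = traject (next q) x (size q).
  apply: (@eq_from_nth _ x); rewrite !size_traject // => k hk.
  by rewrite !nth_traject -?sz //; case: (E k).
apply: dihedral_trans (dihedral_rot j q); rewrite -tj -tt ti.
exact/dihedral_sym/dihedral_rot.
Qed.

Lemma next_dihedral p q : uniq p -> uniq q -> p =i q -> 2 < size p ->
  (forall u, u \in p -> next p u = next q u \/ next p u = prev q u) -> dihedral p q.
Proof.
move=> up uq pq p2 hn; have [x px] : exists x, x \in p.
  by case: (p) p2 => // y *; exists y; rewrite mem_head.
have [e|e] := hn x px; first exact: next_fixed_dihedral e.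
apply: dihedral_trans (dihedral_rev q).
apply: (next_fixed_dihedral (x := x)); rewrite ?rev_uniq //.
- by move=> u; rewrite mem_rev.
- by move=> u /hn; rewrite next_rev // prev_rev //; tauto.
- by rewrite next_rev.
Qed.

End Dihedral.

Lemma dihedral_map (A B : eqType) (f : A -> B) p q : dihedral p q -> dihedral (map f p) (map f q).
Proof. by case=> k [] ->; exists k; [left|right]; rewrite map_rot ?map_rev. Qed.

Lemma dihedral_map_inj (A B : eqType) (f : A -> B) p q : injective f ->
  dihedral (map f p) (map f q) -> dihedral p q.
Proof.
move=> fI [k E]; exists k; rewrite -map_rev -!map_rot in E.
by case: E => /(inj_map fI) ->; [left|right].
Qed.

(** * Neighbours and triangles of the two target maps *)

Definition pred10 i := if i.-1 %% 10 == 0 then i + 9 else i.-1.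

Lemma succ10K i : i \in labels -> pred10 (succ10 i) = i.
Proof.
have /allP P : all (fun i => pred10 (succ10 i) == i) labels by vm_compute.
by move=> /P/eqP.
Qed.

Definition dihedralb (p q : seq nat) :=
  has (fun k => (p == rot k q) || (p == rot k (rev q))) (iota 0 (size q)).

Lemma dihedralP p q : dihedralb p q -> dihedral p q.
Proof. by case/hasP => k _ /orP[] /eqP ->; exists k; [left|right]. Qed.

(** The link order [s, a, b, c, s'] with [b = s a] and [c = a s']; [K_links] below lists its
    consecutive pairs in both directions. *)
Definition K_neighbors ps i := [:: succ10 i; pairing ps i; succ10 (pairing ps i);
  pairing ps (pred10 i); pred10 i].

Definition K_links ps i :=
  let a := pairing ps i in let b := succ10 a in let c := pairing ps (pred10 i) in
  [:: (succ10 i, a); (a, b); (b, c); (c, pred10 i);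
      (a, succ10 i); (b, a); (c, b); (pred10 i, c)].

Section KMaps.
Variable ps : seq (nat * nat).
Hypothesis ps_eq : ps = pairs1 \/ ps = pairs4.

Lemma K_edges i j : i \in labels ->
  sc_edge (K_map ps) i j <-> j \in K_neighbors ps i.
Proof.
have P : all (fun q => all (fun x => (next q x \in K_neighbors ps x) &&
   (x \in K_neighbors ps (next q x))) q)
   (K_faces ps) by case: ps_eq => ->; vm_compute.
have Q : all (fun x => all (fun y => has (fun q => (x \in q) && (next q x == y) ||
   (y \in q) && (next q y == x)) (K_faces ps)) (K_neighbors ps x)) labels by case: ps_eq => ->; vm_compute.
move=> hi; split=> [[q hq]|hj]; last by have /hasP[q] := allP (allP Q i hi) j hj; exists q.
by case/orP => /andP[hx /eqP <-]; have /andP[] := allP (allP P q hq) _ hx.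
Qed.

Lemma K_face_cases q : q \in K_faces ps ->
  (exists i, i \in labels /\ q = traject succ10 i 10) \/
  (exists i y, i \in labels /\ (y \in K_links ps i /\ q = [:: i; y.1; y.2])).
Proof.
have P : all (fun q => has (fun i => q == traject succ10 i 10) labels ||
   has (fun i => has (fun y => q == [:: i; y.1; y.2]) (K_links ps i)) labels) (K_faces ps).
  by case: ps_eq => ->; vm_compute.
move/(allP P)/orP => [/hasP[i hi /eqP ->]|/hasP[i hi /hasP[y hy /eqP ->]]].
  by left; exists i.
by right; exists i, y.
Qed.

Lemma K_decagon i : i \in labels -> exists2 q, q \in K_faces ps & dihedral (traject succ10 i 10) q.
Proof.
have P : all (fun i => has (dihedralb (traject succ10 i 10)) (K_faces ps)) labels.
  by case: ps_eq => ->; vm_compute.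
by move=> /(allP P)/hasP[q hq /dihedralP]; exists q.
Qed.

Lemma K_triangle i y : i \in labels -> y \in K_links ps i ->
  exists2 q, q \in K_faces ps & dihedral [:: i; y.1; y.2] q.
Proof.
have P : all (fun i => all (fun y => has (dihedralb [:: i; y.1; y.2]) (K_faces ps)) (K_links ps i)) labels.
  by case: ps_eq => ->; vm_compute.
by move=> /(allP P)/allP h /h/hasP[q hq /dihedralP]; exists q.
Qed.

End KMaps.

(** * Cells of a semi-equivelar map *)

Section Polygons.
Local Open Scope classical_set_scope.
Variables (R : realType) (S : topologicalType) (M : cell_system S).
Hypothesis hmap : is_map R M.

Let finV : finite_set (vertices M). Proof. by case: hmap => -[]. Qed.
Let finE : finite_set (edges M). Proof. by case: hmap => -[]. Qed.
Let finF : finite_set (faces M). Proof. by case: hmap => -[]. Qed.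

Lemma joins_sym e u v : joins M e u v -> joins M e v u.
Proof. by case=> he hu hv d; split=> //; rewrite d setUC. Qed.

Lemma joins_inj e u v v' : joins M e u v -> joins M e u v' -> v = v'.
Proof.
case=> _ _ _ d [_ _ _]; rewrite d => E.
have : [set u; v'] v by rewrite -E; right.
have : [set u; v] v' by rewrite E; right.
by move=> [->|->] // [|].
Qed.

Lemma joins_closure e u v : joins M e u v -> closure e u.
Proof. by case=> _ _ _ d; have : [set u; v] u; [by left | rewrite -d => -[]]. Qed.

Lemma edge_vertexF e x : edges M e -> e x -> vertices M x -> False.
Proof.
case: hmap => _ _ _ [_ _ dVE _ _] _ he ex vx.
have : (vertices M `&` \bigcup_(e in edges M) e) x by split=> //; exists e.
by rewrite dVE.
Qed.

Lemma face_vertexF f x : faces M f -> f x -> vertices M x -> False.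
Proof.
case: hmap => _ _ _ [_ _ _ dVF _] _ he ex vx.
have : (vertices M `&` \bigcup_(f in faces M) f) x by split=> //; exists f.
by rewrite dVF.
Qed.

Lemma face_edgeF f e x : faces M f -> f x -> edges M e -> e x -> False.
Proof.
case: hmap => _ _ _ [_ _ _ _ dEF] _ hf fx he ex.
have : (\bigcup_(e in edges M) e `&` \bigcup_(f in faces M) f) x
  by split; [exists e|exists f].
by rewrite dEF.
Qed.

Lemma edge_inj e g x : edges M e -> edges M g -> e x -> g x -> e = g.
Proof. by case: hmap => _ _ _ [tE _ _ _ _] _ he hg ex gx; apply: tE => //; exists x. Qed.

Lemma edge_nonempty e : edges M e -> e !=set0.
Proof.
case: hmap => _ hE _ _ _ /hE[[phi [_ <-]] _].
by exists (phi (2^-1)%R), (2^-1)%R => //=; rewrite invr_gt0 invf_lt1 ?ltr0n ?ltr1n.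
Qed.

Lemma joins_closureE e u v x : joins M e u v -> vertices M x -> closure e x -> x = u \/ x = v.
Proof.
move=> [he _ _ d] vx cx.
have : [set u; v] x by rewrite -d; split=> // ex; exact: (edge_vertexF he ex vx).
by case=> ->; [left|right].
Qed.

Lemma polygon_vertex f p x : bounded_by M f p -> x \in p -> vertices M x.
Proof. by case=> _ _ [e [he _]] /he[]. Qed.

Lemma polygon_vertices f p x : bounded_by M f p -> vertices M x -> closure f x <-> x \in p.
Proof.
case=> hf up [e [he d]] vx; split=> [cfx|xp].
  have : (closure f `\` f) x by split=> // fx; apply: (face_vertexF hf fx vx).
  rewrite d => -[u /= pu cx]; case: (joins_closureE (he u pu) vx cx) => -> //.
  by rewrite mem_next.
have : (closure f `\` f) x by rewrite d; exists x => //; apply: joins_closure (he x xp).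
by case.
Qed.

(** The boundary point (1, 0) of the disc goes to a frontier point of [f], which must lie on some
    side. *)
Lemma face_nonempty_polygon f p : bounded_by M f p -> p <> [::].
Proof.
move=> hb p0; rewrite p0 in hb; case: hb => hf _ [e [_ d]].
case: hmap => _ _ hF _ _; have [[h [[[hfun hinj _] _ _] him]] _] := hF f hf.
have c1 : closed_disc R (1, 0)%R by rewrite /closed_disc /= expr1n expr0n addr0.
have ch : closure f (h (1, 0)%R) by apply: hfun.
have : (closure f `\` f) (h (1, 0)%R).
  split=> //; rewrite -him => -[q qo /hinj hq].
  have /hq q1 : q \in closed_disc R by rewrite inE /closed_disc /=; apply: ltW.
  by move: qo; rewrite q1 ?inE // /open_disc /= expr1n expr0n addr0 ltxx.
by rewrite d => -[].
Qed.

(** A point of the open edge [g] is on the frontier of [f], hence on a closed side. It is no vertex,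
    so it lies in the open side, and distinct open edges are disjoint. *)
Lemma polygon_edges f p : bounded_by M f p -> exists e : S -> set S,
  (forall u, u \in p -> joins M (e u) u (next p u)) /\
  (forall g, edges M g -> closure g `<=` closure f -> exists2 u, u \in p & g = e u).
Proof.
case=> hf up [e [he d]]; exists e; split=> // g hg gf.
have [x gx] := edge_nonempty hg.
have : (closure f `\` f) x.
  split=> [|fx]; last exact: (face_edgeF hf fx hg gx).
  by apply: gf; apply: subset_closure.
rewrite d => -[u /= pu cx]; exists u => //.
have [eu vu vn ends] := he u pu.
apply: (edge_inj hg eu gx); apply: contrapT => nex.
have : [set u; next p u] x by rewrite -ends.
by case=> /= xE; apply: (edge_vertexF hg gx); rewrite xE.
Qed.

(** A polygon has only the sides [e u] and [e (prev p u)] at [u], so [g1] and [g2] are these two. *)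
Lemma corner f p u g1 g2 : bounded_by M f p -> u \in p ->
  edges M g1 -> edges M g2 -> closure g1 u -> closure g2 u ->
  closure g1 `<=` closure f -> closure g2 `<=` closure f -> g1 <> g2 ->
  [/\ joins M g1 u (next p u) /\ joins M g2 u (prev p u) \/
      joins M g1 u (prev p u) /\ joins M g2 u (next p u) &
      forall g, edges M g -> closure g u -> closure g `<=` closure f -> g = g1 \/ g = g2].
Proof.
move=> hb pu hg1 hg2 c1 c2 s1 s2 n12.
have up : uniq p by case: hb.
have vu := polygon_vertex hb pu.
have [e [he heE]] := polygon_edges hb.
have pe g : edges M g -> closure g u -> closure g `<=` closure f ->
    g = e u \/ g = e (prev p u).
  move=> hg cg sg; have [w wp E] := heE g hg sg.
  rewrite E in cg; case: (joins_closureE (he w wp) vu cg) => uE.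
    by left; rewrite uE.
  by right; rewrite uE prev_next.
have j1 := he u pu.
have j2 : joins M (e (prev p u)) u (prev p u).
  by have := he (prev p u); rewrite mem_prev (next_prev up) => /(_ pu)/joins_sym.
have e1 := pe _ hg1 c1 s1; have e2 := pe _ hg2 c2 s2.
split; first by case: e1 e2 => E1 [] E2; [case: n12| | |case: n12]; rewrite ?E1 ?E2; tauto.
by move=> g hg cg sg; case: e1 e2 (pe g hg cg sg) => E1 [] E2 [] E3;
  (tauto || (exfalso; apply: n12; congruence) || (left; congruence) || (right; congruence)).
Qed.

Local Notation V := (fset_sub_type (fset_set (vertices M))).

Lemma vertexP (x : V) : vertices M (val x).
Proof. by have := fsvalP x; rewrite in_fset_set // inE. Qed.

Lemma vertex_sub x : vertices M x -> exists v : V, val v = x.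
Proof.
move=> vx; have h : x \in fset_set (vertices M) by rewrite in_fset_set // inE.
by exists [` h]%fset.
Qed.

Lemma vertex_seq p : (forall x, x \in p -> vertices M x) -> exists q : seq V, p = map val q.
Proof.
elim: p => [|x p IHp] hp; first by exists [::].
have [v <-] := vertex_sub (hp x (mem_head _ _)).
have [|q ->] := IHp; last by exists (v :: q).
by move=> y yp; apply: hp; rewrite inE yp orbT.
Qed.

Definition polygon f (q : seq V) := bounded_by M f (map val q).

Lemma polygon_uniq f q : polygon f q -> uniq q.
Proof. by case=> _ u _; rewrite -(map_inj_uniq val_inj). Qed.

Lemma polygon_mem f q x : polygon f q -> closure f (val x) <-> x \in q.
Proof.
by move=> hq; rewrite (polygon_vertices hq (vertexP x)) mem_map //; apply: val_inj.
Qed.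

Lemma ngonP n f : ngon M n f -> exists2 q, polygon f q & size q = n.
Proof.
case=> p [sp hb]; have [q E] := vertex_seq (fun x => polygon_vertex hb (x := x)).
by exists q; rewrite /polygon -?E // -sp E size_map.
Qed.

Lemma polygon_eqi f q q' : polygon f q -> polygon f q' -> q =i q'.
Proof.
move=> h h' x; have e := polygon_mem x h; have e' := polygon_mem x h'.
by apply/idP/idP => [/e/e'|/e'/e].
Qed.

(* The faces and edges of [semi_equivelar] at [u]; [f (inord 4)] is the 10-gon. *)
Record star (u : V) (f e : 'I_5 -> set S) (w : 'I_5 -> V) : Prop := Star {
  star_face_inj : injective f;
  star_edge_inj : injective e;
  star_faces : forall g, (faces M g /\ closure g (val u)) <-> exists i, g = f i;
  star_ngon : forall i : 'I_5, ngon M (nth 0 [:: 3; 3; 3; 3; 10] i) (f i);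
  star_edge : forall i, edges M (e i);
  star_edge_at : forall i, closure (e i) (val u);
  star_edge_left : forall i, closure (e i) `<=` closure (f i);
  star_edge_right : forall i, closure (e i) `<=` closure (f (ordS i));
  star_joins : forall i, joins M (e i) (val u) (val (w i)) }.

Arguments star_edge {u f e w} s i.
Arguments star_edge_at {u f e w} s i.
Arguments star_edge_left {u f e w} s i.
Arguments star_edge_right {u f e w} s i.
Arguments star_joins {u f e w} s i.
Arguments star_ngon {u f e w} s i.

Hypothesis htype : semi_equivelar M [:: 3; 3; 3; 3; 10].
Hypothesis hpoly : polyhedral M.

Lemma ordS_neq (i : 'I_5) : [/\ i <> ordS i, i <> ordS (ordS i),
  i <> ordS (ordS (ordS i)) & i <> ordS (ordS (ordS (ordS i)))].
Proof. by case: i => -[|[|[|[|[|n]]]]] lt5 //; split=> /(congr1 val). Qed.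

Lemma star_exists u : exists f e w, star u f e w.
Proof.
have [f [e [fI eI fE fn he]]] := htype (vertexP u).
have hw i : exists w : V, joins M (e i) (val u) (val w).
  have [ei cu _] := he i; case: hmap => _ hE _ _ _; have [_ [x [y j]]] := hE _ ei.
  have [_ vx vy _] := j; case: (joins_closureE j (vertexP u) cu) => uE.
    by have [w wy] := vertex_sub vy; exists w; rewrite wy uE.
  by have [w wx] := vertex_sub vx; exists w; rewrite wx uE; apply: joins_sym.
have [w ew] := choice hw.
by exists f, e, w; split=> // i; have [? ? c] := he i; try (by move=> x /c[]).
Qed.

Section Star.
Variables (u : V) (f e : 'I_5 -> set S) (w : 'I_5 -> V).
Hypothesis st : star u f e w.

Lemma star_face i : faces M (f i).
Proof. by have [_ /(_ (ex_intro _ i erefl))[]] := star_faces st (f i). Qed.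

Lemma star_face_at i : closure (f i) (val u).
Proof. by have [_ /(_ (ex_intro _ i erefl))[]] := star_faces st (f i). Qed.

Lemma star_edge_neq i : e i <> e (ordS i).
Proof. by move/(star_edge_inj st); case: (ordS_neq i). Qed.

Lemma star_in_polygon i q : polygon (f i) q -> u \in q.
Proof. by move=> hq; apply/(polygon_mem u hq); apply: star_face_at. Qed.

(** The shift of index comes from [semi_equivelar]: [e i] separates [f i] from [f (ordS i)], so
    [f (ordS i)] has the sides [e i] and [e (ordS i)] at [u]. *)
Lemma star_corner i q : polygon (f (ordS i)) q ->
  w i = next q u /\ w (ordS i) = prev q u \/ w i = prev q u /\ w (ordS i) = next q u.
Proof.
move=> hq; have uq := polygon_uniq hq.
have uin : val u \in map val q by rewrite mem_map; [apply: star_in_polygon hq|apply: val_inj].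
have [+ _] := corner hq uin (star_edge st i) (star_edge st (ordS i))
  (star_edge_at st i) (star_edge_at st (ordS i)) (star_edge_right st i)
  (star_edge_left st (ordS i)) (@star_edge_neq i).
rewrite (next_map val_inj uq) (prev_map val_inj uq) => -[] [j1 j2]; [left|right];
  by split; apply: val_inj; [apply: (joins_inj (star_joins st _) j1)|apply: (joins_inj (star_joins st _) j2)].
Qed.

Lemma star_face_edges i g : edges M g -> closure g (val u) ->
  closure g `<=` closure (f (ordS i)) -> g = e i \/ g = e (ordS i).
Proof.
move=> hg cg sg; have [q hq _] := ngonP (star_ngon st (ordS i)).
have uin : val u \in map val q by rewrite mem_map; [apply: star_in_polygon hq|apply: val_inj].
have [_] := corner hq uin (star_edge st i) (star_edge st (ordS i))
  (star_edge_at st i) (star_edge_at st (ordS i)) (star_edge_right st i)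
  (star_edge_left st (ordS i)) (@star_edge_neq i).
exact.
Qed.

(* The common edge of the two faces would be one of two disjoint pairs of edges
   at [u]. *)
Lemma star_opposite i x : closure (f (ordS i)) (val x) ->
  closure (f (ordS (ordS (ordS i)))) (val x) -> x = u.
Proof.
move=> c1 c3; apply: contrapT => xu.
have nf : f (ordS i) <> f (ordS (ordS (ordS i))).
  by move/(star_face_inj st); case: (ordS_neq (ordS i)).
have meet : closure (f (ordS i)) `&` closure (f (ordS (ordS (ordS i)))) !=set0.
  by exists (val u); split; apply: star_face_at.
case: (hpoly (star_face _) (star_face _) nf meet).
  move=> [v _ E]; apply: xu; apply: val_inj.
  have : [set v] (val x) by rewrite -E.
  have : [set v] (val u) by rewrite -E; split; apply: star_face_at.
  by move=> -> ->.
move=> [g hg E].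
have cg : closure g (val u) by rewrite -E; split; apply: star_face_at.
have := star_face_edges hg cg (_ : closure g `<=` closure (f (ordS i))).
have := star_face_edges hg cg (_ : closure g `<=` closure (f (ordS (ordS (ordS i))))).
rewrite -E => /(_ (@subIsetr _ _ _)) + /(_ (@subIsetl _ _ _)).
have [? ? ? ?] := ordS_neq i; have [? ? ? ?] := ordS_neq (ordS i).
by move=> [->|->] [] /(star_edge_inj st) /esym.
Qed.

End Star.

Lemma ngon_size f m n : ngon M m f -> ngon M n f -> m = n.
Proof.
move=> /ngonP[q hq <-] /ngonP[q' hq' <-].
apply: perm_size; apply: uniq_perm; [exact: polygon_uniq hq|exact: polygon_uniq hq'|].
exact: polygon_eqi hq hq'.
Qed.

(** * Incidence counts *)

Local Notation E := (fset_sub_type (fset_set (edges M))).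
Local Notation F := (fset_sub_type (fset_set (faces M))).

Lemma edgeP (e : E) : edges M (val e).
Proof. by have := fsvalP e; rewrite in_fset_set // inE. Qed.

Lemma faceP (f : F) : faces M (val f).
Proof. by have := fsvalP f; rewrite in_fset_set // inE. Qed.

Lemma edge_sub e : edges M e -> exists v : E, val v = e.
Proof.
move=> ve; have h : e \in fset_set (edges M) by rewrite in_fset_set // inE.
by exists [` h]%fset.
Qed.

Lemma face_sub f : faces M f -> exists v : F, val v = f.
Proof.
move=> vf; have h : f \in fset_set (faces M) by rewrite in_fset_set // inE.
by exists [` h]%fset.
Qed.

Definition ngon_at n (u : V) (f : F) := `[< closure (val f) (val u) /\ ngon M n (val f) >].

Lemma card_ngon_at n u : #|[set f | ngon_at n u f]%SET| = count (pred1 n) [:: 3; 3; 3; 3; 10].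
Proof.
have [f [e [w st]]] := star_exists u.
have [ff hff] := choice (fun i => face_sub (star_face st i)).
have ffI : injective ff by move=> i j E; apply: (star_face_inj st); rewrite -!hff E.
have -> : [set f | ngon_at n u f]%SET = [set ff i | i in [set i : 'I_5 | nth 0 [:: 3; 3; 3; 3; 10] i == n]]%SET.
  apply/setP => g; rewrite inE; apply/asboolP/imsetP => [[cg gn]|[i]].
    have [_ _] := star_faces st (val g).
    have [/(_ (conj (faceP g) cg))[i gi] _] := star_faces st (val g).
    exists i; last by apply: val_inj; rewrite hff.
    by rewrite inE; apply/eqP; apply: ngon_size gn; rewrite gi; apply: star_ngon st i.
  rewrite inE => /eqP hn ->; rewrite hff -hn; split; [exact: star_face_at st i|exact: star_ngon st i].
rewrite card_imset // -sum1dep_card big_mkcond /= !big_ord_recl big_ord0 /=.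
by do 2 case: (_ == n).
Qed.

(** Double counting of the incident pairs of a vertex and an [n]-gon. *)
Lemma card_ngon n : n * #|[set f : F | `[< ngon M n (val f) >]]%SET| =
  count (pred1 n) [:: 3; 3; 3; 3; 10] * #|V|.
Proof.
transitivity (\sum_(u : V) #|[set f | ngon_at n u f]%SET|)%N; last first.
  by rewrite (eq_bigr _ (fun u _ => card_ngon_at n u)) sum_nat_const mulnC.
under eq_bigr do rewrite -sum1dep_card.
rewrite (exchange_big_dep xpredT) //=.
rewrite mulnC -sum_nat_const big_mkcond /=; apply: eq_bigr => f _.
rewrite inE sum1dep_card; case: asboolP => [hn|nn].
  have [q hq sq] := ngonP hn; rewrite -[LHS]sq -(card_uniqP (polygon_uniq hq)).
  apply: eq_card => u; rewrite inE; apply/idP/asboolP => [uq|[cu _]].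
    by split=> //; apply: (proj2 (polygon_mem u hq)).
  exact: (proj1 (polygon_mem u hq)).
by apply/esym/eqP; rewrite cards_eq0; apply/eqP/setP => u; rewrite !inE; apply/asboolP => -[].
Qed.

(** Each face has a vertex, so it occurs in a star and has 3 or 10 sides. *)
Lemma faces_split : #|F| = #|[set f : F | `[< ngon M 3 (val f) >]]%SET| +
  #|[set f : F | `[< ngon M 10 (val f) >]]%SET|.
Proof.
rewrite -(cardsC [set f : F | `[< ngon M 3 (val f) >]]%SET); congr addn.
apply: eq_card => f; rewrite !inE; apply/idP/asboolP => [/asboolP n3|n10]; last first.
  by apply/asboolP => n3; have := ngon_size n3 n10.
case: hmap => _ _ hF _ _; have [_ [n /ngonP[q hq sq]]] := hF _ (faceP f).
case: q hq sq => [hq|u q hq _]; first by case: (face_nonempty_polygon hq).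
have [ff [e [w st]]] := star_exists u.
have cu : closure (val f) (val u) by apply: (proj2 (polygon_mem u hq)); rewrite mem_head.
have [/(_ (conj (faceP f) cu))[i fi] _] := star_faces st (val f).
rewrite fi in n3 *; have := star_ngon st i.
by case: i {fi} n3 => -[|[|[|[|[|m]]]]] lt5.
Qed.

Definition incident (u : V) (g : E) := `[< closure (val g) (val u) >].

Lemma star_edges_incident u f e w : star u f e w -> exists ee : 'I_5 -> E,
  [/\ injective ee, forall i, val (ee i) = e i & [set ee i | i : 'I_5]%SET \subset incident u].
Proof.
move=> st; have [ee hee] := choice (fun i => edge_sub (star_edge st i)).
exists ee; split=> //; first by move=> i j Eij; apply: (star_edge_inj st); rewrite -!hee Eij.
apply/fintype.subsetP => g /imsetP[i _ ->]; rewrite unfold_in; apply/asboolP; rewrite hee.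
exact: star_edge_at st i.
Qed.

Lemma degree_ge5 u : 5 <= #|incident u|.
Proof.
have [f [e [w st]]] := star_exists u; have [ee [eeI _ sub]] := star_edges_incident st.
by apply: leq_trans (subset_leq_card sub); rewrite card_imset // card_ord.
Qed.

Lemma sum_degree : \sum_(u : V) #|incident u| <= 2 * #|E|.
Proof.
under eq_bigr do rewrite -sum1_card.
rewrite (exchange_big_dep xpredT) //= mulnC -sum_nat_const; apply: leq_sum => g _.
have [x [y j]] : exists x y, joins M (val g) x y.
  by case: hmap => _ hE _ _ _; have [_] := hE _ (edgeP g).
have [_ vx vy _] := j; have [a ax] := vertex_sub vx; have [b bY] := vertex_sub vy.
rewrite sum1_card (leq_trans (subset_leq_card _) (_ : #|[set a; b]%SET| <= 2)) ?cards2 //; last by case: eqP.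
apply/fintype.subsetP => u cu0; have cu : closure (val g) (val u) by apply/asboolP; exact: cu0.
rewrite !inE.
by case: (joins_closureE j (vertexP u) cu); rewrite -?ax -?bY => /val_inj ->; rewrite eqxx ?orbT.
Qed.

Hypothesis hchi : euler_char M = (- 2%:Z)%R.

(* With [n] vertices, [chi = n + (4n/3 + n/10) - #E] and [2 #E >= 5 n] give
   [n <= 30], while [n] is a positive multiple of 30. *)
Lemma card_vertices_degree : #|V| = 30 /\ forall u, #|incident u| = 5.
Proof.
have := hchi; rewrite /euler_char !cardfE => chi.
have := faces_split; have /= := card_ngon 3; have /= := card_ngon 10.
move=> hd ht hF; have hs := sum_degree.
have chi' : #|V| + #|F| + 2 = #|E| by lia.
have deg0 : \sum_(u : V) 5 <= \sum_(u : V) #|incident u| by apply: leq_sum => u _; apply: degree_ge5.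
(* This excludes 0 among the multiples of 30: without vertices there are no edges, against
   [chi']. *)
have E0 : #|V| = 0 -> #|E| = 0.
  move=> V0; apply: eq_card0 => g; exfalso.
  have [x [y [_ vx _ _]]] : exists x y, joins M (val g) x y.
    by case: hmap => _ hE _ _ _; have [_] := hE _ (edgeP g).
  by have [u _] := vertex_sub vx; have := card0_eq V0 u.
have [v30 e75] : #|V| = 30 /\ #|E| = 75.
  move: chi' hd ht hF hs deg0 E0; rewrite sum_nat_const.
  have -> : #|xpredT : pred V| = #|V| by [].
  move: #|V| #|E| #|F| #|_| #|_| (\sum_(u : V) _) => ? ? ? ? ? ?; lia.
(* The degrees sum to at most 150, and one degree above 5 would already give 6 + 29 * 5 = 151. *)
split=> // u; apply: contrapT => n5; have d6 : 5 < #|incident u|.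
  by rewrite ltn_neqAle degree_ge5 andbT; apply/eqP => /esym.
move: hs; rewrite (bigD1 u) //= e75 leqNgt => /negP; apply.
have : \sum_(v : V | v != u) 5 <= \sum_(v : V | v != u) #|incident v|.
  by apply: leq_sum => v _; apply: degree_ge5.
have -> : \sum_(v : V | v != u) 5 = 145.
  by rewrite sum_nat_const; have := cardC1 u; rewrite v30 => ->.
by move=> h; apply: leq_trans (leq_add d6 h).
Qed.

Lemma star_neighbors u f e w : star u f e w -> forall v : V,
  (exists g, joins M g (val u) (val v)) <-> exists i, v = w i.
Proof.
move=> st v; split=> [[g j]|[i ->]]; last by exists (e i); apply: star_joins st i.
have [ee [eeI eeE sub]] := star_edges_incident st.
have [gE _ _ _] := j; have [g' g'E] := edge_sub gE.
have all_g : [set ee i | i : 'I_5]%SET =i incident u.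
  by apply/subset_cardP => //; rewrite card_imset // card_ord; case: card_vertices_degree.
have : g' \in [set ee i | i : 'I_5]%SET.
  by rewrite all_g; apply/asboolP; rewrite g'E; apply: joins_closure j.
case/imsetP => i _ gi; exists i; apply: val_inj; apply: (joins_inj j).
by rewrite -g'E gi eeE; apply: star_joins st i.
Qed.

Lemma polygon_dihedral f p q : dihedral p q -> polygon f q -> polygon f p.
Proof.
have rotP k r : polygon f r -> polygon f (rot k r).
  rewrite /polygon map_rot; case=> hf ur [e [he d]]; split; rewrite ?rot_uniq //.
  exists e; split; first by move=> x; rewrite mem_rot next_rot //; apply: he.
  by rewrite d; apply: eq_bigcupl; split=> x /=; rewrite mem_rot.
have revP r : polygon f r -> polygon f (rev r).
  rewrite /polygon map_rev; case=> hf ur [e [he d]]; split; rewrite ?rev_uniq //.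
  exists (fun x => e (prev (map val r) x)); split.
    move=> x; rewrite mem_rev next_rev // => xr; apply: joins_sym.
    by have := he (prev (map val r) x); rewrite mem_prev next_prev //; apply.
  rewrite d; apply/seteqP; split=> x [y /= yr cx].
    by exists (next (map val r) y); rewrite /= ?mem_rev ?mem_next // prev_next.
  by rewrite mem_rev in yr; exists (prev (map val r) y); rewrite //= mem_prev.
by case=> k [] ->; [apply: rotP|move=> /revP; apply: rotP].
Qed.

(** * The faces around a vertex, read as a link *)

Definition tri (x y z : V) := exists f, polygon f [:: x; y; z].

Lemma triangle_swap12 x y z : tri x y z -> tri y x z.
Proof. by case=> f hf; exists f; apply: polygon_dihedral hf; exists 1; right. Qed.

Lemma triangle_swap23 x y z : tri x y z -> tri x z y.
Proof. by case=> f hf; exists f; apply: polygon_dihedral hf; exists 2; right. Qed.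

Lemma star_tri u f e w i : star u f e w -> nth 0 [:: 3; 3; 3; 3; 10] (ordS i) = 3 ->
  tri u (w i) (w (ordS i)).
Proof.
move=> st t3; have := star_ngon st (ordS i); rewrite t3 => /ngonP[q hq sq].
have uq := polygon_uniq hq; have [k r rE] := rot_to (star_in_polygon st hq).
have hr : polygon (f (ordS i)) (u :: r) by rewrite -rE; apply: polygon_dihedral hq; apply: dihedral_rot.
have := size_rot k q; rewrite rE sq => -[].
have := star_corner st hr; have := polygon_uniq hr.
case: r {rE} hr => [|x [|y [|z r]]] //= hr; rewrite !inE negb_or => /and3P[/andP[ux uy] xy _].
rewrite eqxx (negbTE uy) (negbTE ux).
case=> -[-> ->] _; first by exists (f (ordS i)).
by apply: triangle_swap23; exists (f (ordS i)).
Qed.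

Lemma star_tri_link u f e w x y : star u f e w -> tri u x y -> exists i,
  nth 0 [:: 3; 3; 3; 3; 10] (ordS i) = 3 /\
  (x = w i /\ y = w (ordS i) \/ x = w (ordS i) /\ y = w i).
Proof.
move=> st [g hg]; have cg : closure g (val u) by apply/(polygon_mem u hg); rewrite mem_head.
have [fg _ _] := hg.
have [/(_ (conj fg cg))[j gj] _] := star_faces st g.
have [i ji] : exists i, j = ordS i by exists (ord_pred j); rewrite ord_predK.
exists i; split.
  apply: (@ngon_size g); first by rewrite gj ji; apply: star_ngon st (ordS i).
  by exists (map val [:: u; x; y]); split.
have := polygon_uniq hg; rewrite gj ji in hg; have := star_corner st hg.
rewrite /= !inE negb_or => + /and3P[/andP[ux uy] xy _].
rewrite eqxx (negbTE uy) (negbTE ux).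
by case=> -[-> ->]; [left|right].
Qed.

(* [x] and [y] are the neighbours of [u] on its 10-gon [D]. *)
Record corona (u : V) (D : set S) (x a b c y : V) : Prop := Corona {
  corona_face : faces M D;
  corona_at : closure D (val u);
  corona_ngon : ngon M 10 D;
  corona_only : forall g, faces M g -> closure g (val u) -> ngon M 10 g -> g = D;
  corona_uniq : uniq [:: x; a; b; c; y];
  corona_away : forall z, z \in [:: a; b; c] -> ~ closure D (val z);
  corona_tri : [/\ tri u x a, tri u a b, tri u b c & tri u c y];
  corona_link : forall z t, tri u z t ->
    (z, t) \in [:: (x, a); (a, b); (b, c); (c, y); (a, x); (b, a); (c, b); (y, c)];
  corona_neighbors : forall v : V,
    (exists g, joins M g (val u) (val v)) <-> v \in [:: x; a; b; c; y] }.

Lemma corona_rev u D x a b c y : corona u D x a b c y -> corona u D y c b a x.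
Proof.
case=> h1 h2 h3 h4 h5 h6 [t1 t2 t3 t4] h8 h9; split=> //.
- by rewrite -rev_uniq.
- by move=> z hz; apply: h6; move: hz; rewrite !inE; case/or3P => ->; rewrite ?orbT.
- by split; apply: triangle_swap23.
- by move=> z t /h8; rewrite !inE => /or4P[| | |/or4P[| | |/orP[]]] ->; rewrite ?orbT.
- by move=> v; rewrite h9 -mem_rev.
Qed.

(** The 10-gon [f 4] lies between [e 3] and [e 4], so the link starts at [w 4] and ends at [w 3]. *)
Lemma star_corona u f e w : star u f e w -> corona u (f (inord 4)) (w (inord 4))
  (w (inord 0)) (w (inord 1)) (w (inord 2)) (w (inord 3)).
Proof.
move=> st.
have o (k : nat) : k < 4 -> ordS (inord k : 'I_5) = inord k.+1.
  by move=> hk; apply: val_inj; rewrite /= !inordK ?modn_small; lia.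
have o4 : ordS (inord 4 : 'I_5) = inord 0 by apply: val_inj; rewrite /= !inordK.
have t k : k < 5 -> nth 0 [:: 3; 3; 3; 3; 10] (inord k : 'I_5) = nth 0 [:: 3; 3; 3; 3; 10] k.
  by move=> hk; rewrite inordK.
have ex (i : 'I_5) : exists2 k, k < 5 & i = inord k by exists i; rewrite ?inord_val.
have wr i : closure (f (ordS i)) (val (w i)).
  by apply: (star_edge_right st i); apply: joins_closure (joins_sym (star_joins st i)).
have wl i : closure (f i) (val (w i)).
  by apply: (star_edge_left st i); apply: joins_closure (joins_sym (star_joins st i)).
have t1 := star_tri (i := inord 4) st; rewrite o4 t // in t1; have {}t1 := t1 erefl.
have t2 := star_tri (i := inord 0) st; rewrite o // t // in t2; have {}t2 := t2 erefl.
have t3 := star_tri (i := inord 1) st; rewrite o // t // in t3; have {}t3 := t3 erefl.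
have t4 := star_tri (i := inord 2) st; rewrite o // t // in t4; have {}t4 := t4 erefl.
have wu i : w i <> u.
  have tu x y : tri u x y -> x <> u /\ y <> u.
    case=> g /polygon_uniq; rewrite /= !inE negb_or => /and3P[/andP[ux uy] _ _].
    by split; apply/eqP; rewrite eq_sym.
  have [? ?] := tu _ _ t1; have [? ?] := tu _ _ t2; have [? ?] := tu _ _ t4.
  by have [k hk ->] := ex i; case: k hk => [|[|[|[|[|k]]]]].
(* Two different places in a cycle of length 5 are one or two steps apart. In either case equal
   neighbours would lie on two faces that are not consecutive around [u]. *)
have w1 i : w (ordS i) <> w (ordS (ordS i)).
  move=> E; apply: (wu (ordS i)); apply: (star_opposite st (wl (ordS i))).
  by rewrite E; apply: wr.
have w2 i : w (ordS i) <> w (ordS (ordS (ordS i))).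
  move=> E; apply: (wu (ordS i)); apply: (star_opposite st (wl (ordS i))).
  by rewrite E; apply: wl.
split.
- exact: star_face st _.
- exact: star_face_at st _.
- by have := star_ngon st (inord 4); rewrite t.
- move=> g fg cg ng; have [/(_ (conj fg cg))[i gi] _] := star_faces st g.
  rewrite gi; congr f; have := star_ngon st i; rewrite -gi => /ngon_size /(_ ng).
  by have [k hk ->] := ex i; rewrite t //; case: k hk => [|[|[|[|[|k]]]]].
- have a0 := w1 (inord 0); have a1 := w1 (inord 1); have a2 := w1 (inord 2).
  have a3 := w1 (inord 3); have a4 := w1 (inord 4).
  have b0 := w2 (inord 0); have b1 := w2 (inord 1); have b2 := w2 (inord 2).
  have b3 := w2 (inord 3); have b4 := w2 (inord 4).
  rewrite !(o4, o) // in a0 a1 a2 a3 a4 b0 b1 b2 b3 b4.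
  rewrite /= !inE !negb_or !andbT; do ![apply/andP; split]; apply/eqP => E; congruence.
(* Each of [w 0], [w 1], [w 2] lies on [f 1] or [f 2], the two triangles not consecutive to the
   10-gon at [u]. *)
- have op3 z : closure (f (inord 4)) (val z) -> closure (f (inord 1)) (val z) -> z = u.
    by have := @star_opposite _ _ _ _ st (inord 3) z; rewrite !(o4, o).
  have op1 z : closure (f (inord 2)) (val z) -> closure (f (inord 4)) (val z) -> z = u.
    by have := @star_opposite _ _ _ _ st (inord 1) z; rewrite !(o4, o).
  move=> z; rewrite !inE => /or3P[] /eqP -> cz.
  + by apply: (wu (inord 0)); apply: op3 => //; rewrite -(o 0) //; apply: wr.
  + by apply: (wu (inord 1)); apply: op1 => //; rewrite -(o 1) //; apply: wr.
  + by apply: (wu (inord 2)); apply: op1 => //; apply: wl.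
- by split.
- move=> z y /(star_tri_link st)[i [ti zy]].
  have [k hk iE] := ex i; rewrite iE in ti zy.
  case: k hk {iE} ti zy => [|[|[|[|[|k]]]]] // _; rewrite ?o4 ?o // t // => _;
    by case=> -[-> ->]; rewrite !inE eqxx ?orbT.
move=> v; rewrite (star_neighbors st); split=> [[i ->]|].
  by have [k hk ->] := ex i; case: k hk => [|[|[|[|[|k]]]]] // _; rewrite !inE eqxx ?orbT.
by rewrite !inE => /or4P[| | |/orP[]] /eqP ->; eexists.
Qed.

(** * The link functions of the whole map *)

Section Assembly.
(** One listing chosen per 10-gon gives all its vertices a common direction, arbitrary at this
    stage. *)
Variable P : set S -> seq V.
Hypothesis PP : forall f, ngon M 10 f -> polygon f (P f) /\ size (P f) = 10.

Lemma corona_exists u : exists (D : set S) (abc : V * V * V),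
  corona u D (next (P D) u) abc.1.1 abc.1.2 abc.2 (prev (P D) u).
Proof.
have [f [e [w st]]] := star_exists u; have cu := star_corona st.
pose D := f (inord 4); have [hP _] := PP (corona_ngon cu).
have E : ordS (inord 3 : 'I_5) = inord 4 by apply: val_inj; rewrite /= !inordK.
exists D; rewrite -E in hP; have := star_corner st hP; rewrite E -/D.
case=> -[w3 w4].
  exists (w (inord 2), w (inord 1), w (inord 0)); rewrite -w3 -w4 /=.
  exact: corona_rev cu.
by exists (w (inord 0), w (inord 1), w (inord 2)); rewrite -w3 -w4.
Qed.

(** In any listing of the 10-gon the neighbours of a vertex are [w 3] and [w 4] of its star. This is
    needed because [scheme_of_map] accepts every listing that bounds the face. *)
Lemma decagon_dihedral f p q : polygon f p -> size p = 10 -> polygon f q -> dihedral p q.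
Proof.
move=> hp sp hq; have up := polygon_uniq hp; have uq := polygon_uniq hq.
have pq := polygon_eqi hp hq.
apply: next_dihedral; rewrite ?sp // => u pu.
have [f' [e [w st]]] := star_exists u; have cu := star_corona st.
have fE : f = f' (ordS (inord 3)).
  have -> : ordS (inord 3 : 'I_5) = inord 4 by apply: val_inj; rewrite /= !inordK.
  apply: (corona_only cu); first by case: hp.
    by apply: (proj2 (polygon_mem u hp)).
  by exists (map val p); rewrite size_map.
rewrite fE in hp hq; have := star_corner st hp; have := star_corner st hq.
by case=> -[-> ->] [] [-> ->]; [left|right|right|left].
Qed.

Lemma snub_links_exists : exists (D : V -> set S) (a b c : V -> V),
  (forall u, corona u (D u) (next (P (D u)) u) (a u) (b u) (c u) (prev (P (D u)) u)) /\
  snub_links D tri (fun u => next (P (D u)) u) (fun u => prev (P (D u)) u) a b c.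
Proof.
have H u : exists x : set S * (V * V * V),
    corona u x.1 (next (P x.1) u) x.2.1.1 x.2.1.2 x.2.2 (prev (P x.1) u).
  by have [D [abc h]] := corona_exists u; exists (D, abc).
have [g hg] := choice H; pose D u := (g u).1.
exists D, (fun u => (g u).2.1.1), (fun u => (g u).2.1.2), (fun u => (g u).2.2).
have cor u := hg u : corona u (D u) _ _ _ _ _.
split=> //; have PD u := PP (corona_ngon (cor u)).
have uPD u : uniq (P (D u)) by apply: polygon_uniq (proj1 (PD u)).
have D_in u v : v \in P (D u) -> D v = D u.
  move=> vu; symmetry; apply: (corona_only (cor v) (corona_face (cor u)) _ (corona_ngon (cor u))).
  exact: (proj2 (polygon_mem v (proj1 (PD u)))).
have in_D u : u \in P (D u) by apply: (proj1 (polygon_mem u (proj1 (PD u)))) (corona_at (cor u)).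
have D_next u : D (next (P (D u)) u) = D u by apply: D_in; rewrite mem_next.
have D_prev u : D (prev (P (D u)) u) = D u by apply: D_in; rewrite mem_prev.
have iterE k u : iter k (fun v => next (P (D v)) v) u = iter k (next (P (D u))) u.
  suff [//] : iter k (fun v => next (P (D v)) v) u = iter k (next (P (D u))) u /\
     D (iter k (fun v => next (P (D v)) v) u) = D u.
  by elim: k => //= k [IH1 IH2]; rewrite D_next IH2 -IH1.
have cyc u := traject_cycle (cycle_next (uPD u)) (in_D u).
split.
- by move=> u; rewrite D_next prev_next.
- by move=> u; rewrite D_prev next_prev.
- by move=> u; rewrite iterE; case: (cyc u) => + _; rewrite (proj2 (PD u)).
- move=> u k /andP[k0 k10]; rewrite iterE => E.
  have [_ [i ti]] := cyc u; rewrite (proj2 (PD u)) in ti.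
  have : uniq (traject (next (P (D u))) u 10) by rewrite ti rot_uniq.
  move/(uniqP u)/(_ 0 k); rewrite !inE !size_traject !nth_traject // E => /(_ isT k10 erefl) k00.
  by rewrite -k00 in k0.
- exact: D_next.
- by move=> u E; apply: (corona_away (cor u) (z := (g u).2.1.1)); rewrite ?mem_head // -E; apply: corona_at.
- by move=> u E; apply: (corona_away (cor u) (z := (g u).2.1.2)); rewrite ?inE ?eqxx ?orbT // -E; apply: corona_at.
- by move=> u E; apply: (corona_away (cor u) (z := (g u).2.2)); rewrite ?inE ?eqxx ?orbT // -E; apply: corona_at.
- by move=> u; apply: corona_uniq (cor u).
- exact: triangle_swap12.
- exact: triangle_swap23.
- by move=> u; case: (corona_tri (cor u)).
- by move=> u; case: (corona_tri (cor u)).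
- by move=> u; case: (corona_tri (cor u)).
- by move=> u; case: (corona_tri (cor u)).
- by move=> u x y /(corona_link (cor u)).
Qed.

End Assembly.

Lemma snub_classification : exists (s s' a : V -> V) (phi : V -> nat) ps,
  [/\ cancel s s' /\ involutive a,
      forall u x y, tri u x y <-> (x, y) \in
        [:: (s u, a u); (a u, s (a u)); (s (a u), a (s' u)); (a (s' u), s' u);
            (a u, s u); (s (a u), a u); (a (s' u), s (a u)); (s' u, a (s' u))],
      forall u v, (exists g, joins M g (val u) (val v)) <->
        v \in [:: s u; a u; s (a u); a (s' u); s' u],
      forall u, exists2 f, polygon f (traject s u 10) &
        forall g, faces M g -> closure g (val u) -> ngon M 10 g -> g = f &
      [/\ ps = pairs1 \/ ps = pairs4, injective phi, forall u, phi u \in labels,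
      forall u, phi (s u) = succ10 (phi u) & forall u, phi (a u) = pairing ps (phi u)]].
Proof.
have [P PP] : exists P : set S -> seq V, forall f, ngon M 10 f -> polygon f (P f) /\ size (P f) = 10.
  suff ex f : exists q : seq V, ngon M 10 f -> polygon f q /\ size q = 10.
    by have [P hP] := choice ex; exists P.
  by have [/ngonP[q hq sq]|nn] := pselect (ngon M 10 f); [exists q|exists [::]].
have [D [a [b [c [cor H]]]]] := snub_links_exists PP.
set s := fun u => _ in H; set s' := fun u => _ in H.
have H' := turn_snub_links H; have fw := turn_forward H.
set s1 := turn_succ s s' a b in H' fw; set a1 := turn_a s a b c in H' fw.
set s1' := turn_pred s s' a b in H'; set c1 := turn_c s a b c in H'.
have [V30 _] := card_vertices_degree.
have [phi [ps hphi]] := labeling H' fw V30.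
have bE u : b u = s1 (a1 u) := b_succ_a H' fw u.
have cE u : c1 u = a1 (s1' u) by rewrite (a_pred H').
exists s1, s1', a1, phi, ps; split=> //.
- by split; [exact: succK H'|exact: a_involutive H' fw].
- move=> u x y; rewrite -bE -cE; split; first exact: tri_link H' _ _ _.
  have sa := tri_sa H' u; have ab := tri_ab H' u; have bc := tri_bc H' u; have cs := tri_cs H' u.
  by rewrite !inE !xpair_eqE => /or4P[| | |/or4P[| | |/orP[]]] /andP[/eqP -> /eqP ->] //;
    apply: triangle_swap23.
- move=> u v; rewrite (corona_neighbors (cor u)) -bE -cE -/(s u) -/(s' u).
  rewrite /s1 /a1 /c1 /s1' /turn_succ /turn_a /turn_c /turn_pred; case: ifP => // _.
  by rewrite -mem_rev.
move=> u; exists (D u); last exact: corona_only (cor u).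
have [hP sP] := PP _ (corona_ngon (cor u)).
have uP := polygon_uniq hP.
have uin : u \in P (D u) by apply: (proj1 (polygon_mem u hP)) (corona_at (cor u)).
apply: polygon_dihedral hP.
have Dk h k : (forall v, D (h v) = D v) -> D (iter k h u) = D u.
  by move=> hh; elim: k => //= k; rewrite hh.
have Ds v : D (s v) = D v := D_succ H v.
have Ds' v : D (s' v) = D v by rewrite -(Ds (s' v)) (predK H).
(* [s] and [s'] consult the listing of the 10-gon of the current vertex; along the 10-gon of [u]
   this is always [P (D u)]. *)
have traj h h' : (forall v, D (h v) = D v) -> (forall v, D v = D u -> h v = h' v) ->
    traject h u 10 = traject h' u 10.
  move=> hD hh; apply: (@eq_from_nth _ u); rewrite !size_traject // => k hk.
  rewrite !nth_traject //; elim: k {hk} => //= k <-; apply: hh; exact: Dk.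
have -> : traject s1 u 10 = if forward s a b u then traject s u 10 else traject s' u 10.
  apply: (@eq_from_nth _ u); first by case: ifP; rewrite !size_traject.
  rewrite size_traject => k hk; rewrite nth_traject // (iter_turn_succ H).
  by case: ifP => _; rewrite nth_traject.
case: ifP => _.
  rewrite (traj s (next (P (D u)))) //; last by move=> v Dv; rewrite /s Dv.
  have [_ [i]] := traject_cycle (cycle_next uP) uin; rewrite sP => ->; exact: dihedral_rot.
rewrite (traj s' (prev (P (D u)))) //; last by move=> v Dv; rewrite /s' Dv.
apply: (@dihedral_trans _ (rev (P (D u)))); last exact: dihedral_rev.
have ur : uniq (rev (P (D u))) by rewrite rev_uniq.
have [_ [i]] := traject_cycle (cycle_next ur) (etrans (mem_rev _ _) uin).
rewrite size_rev sP => ti; have <- : traject (next (rev (P (D u)))) u 10 = traject (prev (P (D u))) u 10.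
  by apply: (@eq_from_nth _ u); rewrite !size_traject // => k hk; rewrite !nth_traject //;
    apply: eq_iter => v; rewrite next_rev.
by rewrite ti; apply: dihedral_rot.
Qed.

Lemma scheme_iso_exists : exists ps,
  (ps = pairs1 \/ ps = pairs4) /\ scheme_iso (scheme_of_map M) (K_map ps).
Proof.
have [s [s' [a [phi [ps [[sK aK] triE nbE decE [ps_eq phiI phiL phis phia]]]]]]] := snub_classification.
have s'K : cancel s' s.
  by have [t tK Kt] := injF_bij (can_inj sK); move=> x; rewrite -[x in LHS]Kt sK.
have phis' u : phi (s' u) = pred10 (phi u) by rewrite -{2}(s'K u) phis succ10K.
have [V30 _] := card_vertices_degree.
have phi_surj i : i \in labels -> exists u, phi u = i.
  move=> hi; have uL : uniq (map phi (enum V)) by rewrite map_inj_uniq // enum_uniq.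
  have [] := uniq_min_size uL (s2 := labels).
  - by move=> x /mapP[u _ ->].
  - by rewrite size_map -cardE V30.
  by move=> _ /(_ i); rewrite hi => /mapP[u _ ->]; exists u.
have linksE u x y : ((x, y) \in [:: (s u, a u); (a u, s (a u)); (s (a u), a (s' u)); (a (s' u), s' u);
     (a u, s u); (s (a u), a u); (a (s' u), s (a u)); (s' u, a (s' u))]) =
    ((phi x, phi y) \in K_links ps (phi u)).
  rewrite -(mem_map (f := fun z : V * V => (phi z.1, phi z.2))).
    by rewrite /= !(phis, phia, phis').
  by case=> [x1 y1] [x2 y2] [/phiI -> /phiI ->].
(* Off the vertices the value is 0, which is not a label. *)
pose psi x := oapp phi 0 (insub x : option V).
have psiE u : psi (val u) = phi u by rewrite /psi valK.
exists ps; split=> //; exists psi; split.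
- split.
  + by move=> x /vertex_sub[u <-]; rewrite psiE; have := phiL u; rewrite in_labels ltnS.
  + move=> x y; rewrite !inE => /vertex_sub[u <-] /vertex_sub[v <-]; rewrite !psiE.
    by move/phiI ->.
  + move=> i /= hi; have [|u <-] := phi_surj i; first by rewrite in_labels.
    by exists (val u); [exact: vertexP|exact: psiE].
- move=> x y /vertex_sub[u <-] /vertex_sub[v <-]; rewrite !psiE.
  rewrite (K_edges ps_eq _ (phiL u)) /= nbE -(mem_map phiI) /=.
  by rewrite !(phis, phia, phis').
move=> p hp.
have [q ->] := vertex_seq hp.
have -> : map psi (map val q) = map phi q by rewrite -map_comp; apply: eq_map.
have traj u : map phi (traject s u 10) = traject succ10 (phi u) 10.
  by rewrite /= !phis.
split=> [[f hf]|[q0 q0F dq]].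
  have [x xq] : exists x, x \in q.
    by case: (q) hf => [hf|x r _]; [case: (face_nonempty_polygon hf)|exists x; rewrite mem_head].
  suff [q0 q0F [k dq]] : exists2 q0, q0 \in K_faces ps & dihedral (map phi q) q0 by exists q0 => //; exists k.
  have [f' [e [w st]]] := star_exists x.
  have fx : closure f (val x) by apply: (proj2 (polygon_mem x hf)).
  have [/(_ (conj _ fx)) + _] := star_faces st f; case=> [|i fi]; first by case: hf.
  have nq : ngon M (size q) f by exists (map val q); rewrite size_map.
  have := star_ngon st i; rewrite -fi => /(ngon_size nq) sq.
  (* A triangle is found through its link, a 10-gon through the trajectory of [s]. *)
  have [s3|s10] : size q = 3 \/ size q = 10.
    by rewrite sq; case: (i) => -[|[|[|[|[|n]]]]] //= _; [left|left|left|left|right].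
  case: q {xq nq sq} s3 hf => [|u [|y [|z [|t r]]]] // _ hf.
    have : tri u y z by exists f.
    by move/triE; rewrite linksE => /(K_triangle ps_eq (phiL u)).
  have [g hg gE] := decE x; have [q0 q0F d0] := K_decagon ps_eq (phiL x).
  exists q0 => //; apply: dihedral_trans d0; rewrite -traj; apply: dihedral_map.
  apply: (decagon_dihedral hf) => //.
  by rewrite (gE f) //; [case: hf|exists (map val q); rewrite size_map].
have {}dq : dihedral (map phi q) q0 by case: dq => k; exists k.
have [[i [hi q0E]]|[i [[j k] [hi [hjk q0E]]]]] := K_face_cases ps_eq q0F.
  have [u uE] := phi_surj i hi; have [f hf _] := decE u; exists f.
  apply: polygon_dihedral hf; apply: (dihedral_map_inj phiI).
  by rewrite traj uE -q0E.
have [u uE] := phi_surj i hi.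
(* Entries of the link of a label are labels, so they are values of [phi] and the triangle can be
   pulled back. *)
have kin l : l \in K_links ps i -> (l.1 \in labels) && (l.2 \in labels).
  rewrite -uE /K_links; cbv zeta.
  rewrite -!phis' -!phia -!phis => hl; suff [x [y ->]] : exists x y, l = (phi x, phi y) by rewrite !phiL.
  by move: hl; rewrite !inE; move=> /or4P[| | |/or4P[| | |/orP[]]] /eqP ->; do 2 eexists.
have /andP[/phi_surj[y yE] /phi_surj[z zE]] := kin _ hjk.
have [f hf] : tri u y z by apply/triE; rewrite linksE yE zE uE.
exists f; apply: polygon_dihedral hf; apply: (dihedral_map_inj phiI).
by rewrite /= uE yE zE -q0E.
Qed.

End Polygons.
Theorem theorem1p6 (R : realType) (S : topologicalType) (M : cell_system S)
  (hS : surface R S)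
  (hmap : is_map R M)
  (hpoly : polyhedral M)
  (htype : semi_equivelar M [:: 3; 3; 3; 3; 10])
  (hchi : euler_char M = (- 2%:Z)%R) :
  scheme_iso (scheme_of_map M) K1 \/ scheme_iso (scheme_of_map M) K2 \/
  scheme_iso (scheme_of_map M) K3 \/ scheme_iso (scheme_of_map M) K4.
Proof.
have [ps [[->|->] iso]] := scheme_iso_exists hmap htype hpoly hchi; first by left.
by right; right; right.
Qed.
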